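(* Let $m,n\ge0$, $x\in\mathcal{E}_n$ and $y\in\mathcal{E}_m$. Assume that for all $k\in\mathbb{Z}$, $$\Phi^{(1)}(xU_{e_L,k})=\Phi^{(1)}(yU_{e_L,k})=0.$$ For $k\in\mathbb{Z}$ define $x^{(k)}=xU_{e_L,-k}$ and $y^{(k)}=yU_{e_L,-k}$, and for $R,S\ge0$ let $$X^{(R)}=\sum_{k=-R}^{R}x^{(k)},\qquad Y^{(S)}=\sum_{k=-S}^{S}y^{(k)}.$$ If $R\ge 2n+m$ and $S\ge n+2m$, then $$\Phi^{(2)}\left(X^{(R)},Y^{(S)}\right)=\Phi^{(1)}\left(X^{(R)}Y^{(S)}\right).$$
   Context: Group. $\Lambda=\mathbb{Z}^{m_0}\times(\mathbb{Z}/2\mathbb{Z})^{r_2}\times\mathbb{Z}/q_1\mathbb{Z}\times\cdots\times\mathbb{Z}/q_t\mathbb{Z}$ with $m_0,r_2,t\ge 0$ and $q_j\ge3$; $L=\bigoplus_{k\in\mathbb{Z}}\Lambda$ is the group of finitely supported functions $\mathbb{Z}\to\Lambda$, with identity $e_L$; $G=L\rtimes\mathbb{Z}=\Lambda\wr\mathbb{Z}$ with product $(f,g)(f',g')=(f\cdot(f'\circ g^{-1}),g+g')$, where $(f'\circ g^{-1})(k)=f'(k-g)$. For $(f,g)\in G$, $U_{f,g}=\lambda_G(f,g)$ ($\lambda_G$ the left regular representation); $\mathbb{C}[G]$ is identified with the linear span of the $U_{f,g}$. Random matrices ($N\times N$). $V_N$ is a uniform random permutation matrix; independently of it, there are diagonal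 matrices with all diagonal entries independent: $D_1,\dots,D_{m_0}$ with entries uniform on the unit circle, $D'_1,\dots,D'_{r_2}$ with entries uniform on $\{\pm1\}$, and $\Delta_1,\dots,\Delta_t$ with $\Delta_j$ having entries uniform on the $q_j$-th roots of unity. For $\lambda\in\Lambda$ let $D^{\lambda}$ be the product of the powers of these (unitary, commuting) diagonal matrices with exponents the coordinates of $\lambda$, each cyclic or infinite cyclic factor of $\Lambda$ corresponding to one diagonal matrix. Evaluation. To $U_{f,g}$ one associates the graph monomial consisting of the directed line on the smallest integer interval containing $\{0,g\}\cup\mathrm{supp}(f)$ (edges $k\to k+1$ labeled by $V_N$), with input $0$, output $g$, and at each vertex $k$ loops corresponding to $f(k)$. Its evaluation is the matrix $(U_{f,g})_N$ whose $(i,j)$ entry is the sum over maps $\phi$ from the vertices to $\{1,\dots,N\}$ with $\phi(g)=i$, $\phi(0)=j$ of the product of $V_N(\phi(k+1),\phi(k))$ over the edges of the line and of $D^{f(k)}(\phi(k),\phi(k))$ over the vertices $k$; equivalently $(U_{f,g})_N=V_N^{g}\prod_{k}V_N^{-k}D^{f(k)}V_N^{k}$. For $x\in\mathbb{C}[G]$, $x_N$ is defined by linearity. Functionals. For $x,y\in\mathbb{C}[G]$ (the limits exist): $$\Phi^{(1)}(x)=\lim_{N\to\infty}\tfrac1N\mathbb{E}[\mathrm{Tr}(x_N)],\qquad \Phi^{(2)}(x,y)=\lim_{N\to\infty}\tfrac1N\mathbb{E}\bigl[(\mathrm{Tr}(x_N)-\mathbb{E}\,\mathrm{Tr}(x_N))(\mathrm{Tr}(y_N)-\mathbb{E}\,\mathrm{Tr}(y_N))\bigr].$$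 Filtration. For $f\in L$, $\mathrm{diam}(f)=\inf\{n\in\mathbb{N}:\mathrm{supp}(f)\subset[-n,n]\}$, with $\mathrm{diam}(e_L)=0$; $\mathcal{E}_n=\mathrm{span}\{U_{f,g}:\mathrm{diam}(f)\le n,\ |g|\le n\}$. *)

(* Defs.v *)
From HB Require Import structures.
From mathcomp Require Import all_boot all_order all_algebra all_fingroup.
From mathcomp Require Import finmap complex.
From mathcomp Require Import all_classical all_reals all_analysis.
(* The notations of monalg are incompatible with those of MathComp-Analysis;
   [malg K A] is the module of finitely supported functions from K to A,
   [mcoeff k f] the value of f at k, [mkmalgU k a] the function with value a
   at k and 0 elsewhere, [msupp f] the support. *)
From mathcomp.multinomials Require Import -(notations) monalg.

Set Implicit Arguments.
Unset Strict Implicit.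
Unset Printing Implicit Defensive.

Import Order.TTheory GRing.Theory Num.Theory.
Import numFieldNormedType.Exports.

Local Open Scope classical_set_scope.
Local Open Scope ring_scope.

(** * The group *)

Section CyclicProduct.
Variables (t : nat) (q : 'I_t -> nat).

(* ['Z_k] is Z/kZ only for k >= 2. *)
Definition cyclic_prod := {dffun forall j : 'I_t, 'Z_(q j)}.
HB.instance Definition _ := Choice.on cyclic_prod.

Definition cyc_zero : cyclic_prod := [ffun=> 0].
Definition cyc_opp (a : cyclic_prod) : cyclic_prod := [ffun j => - a j].
Definition cyc_add (a b : cyclic_prod) : cyclic_prod := [ffun j => a j + b j].

Fact cyc_addA : associative cyc_add.
Proof. by move=> a b c; apply/ffunP=> j; rewrite !ffunE addrA. Qed.
Fact cyc_addC : commutative cyc_add.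
Proof. by move=> a b; apply/ffunP=> j; rewrite !ffunE addrC. Qed.
Fact cyc_add0 : left_id cyc_zero cyc_add.
Proof. by move=> a; apply/ffunP=> j; rewrite !ffunE add0r. Qed.
Fact cyc_addN : left_inverse cyc_zero cyc_opp cyc_add.
Proof. by move=> a; apply/ffunP=> j; rewrite !ffunE addNr. Qed.

HB.instance Definition _ :=
  GRing.isZmodule.Build cyclic_prod cyc_addA cyc_addC cyc_add0 cyc_addN.
End CyclicProduct.

Definition Lam (m0 r2 t : nat) (q : 'I_t -> nat) : zmodType :=
  ({ffun 'I_m0 -> int} * {ffun 'I_r2 -> 'Z_2} * cyclic_prod q)%type.

Section Wreath.
Variable A : zmodType.

(* [translate g f] is the function k |-> f (k - g), see [translateE]. *)
Definition translate (g : int) (f : malg int A) : malg int A :=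
  \sum_(k <- msupp f) mkmalgU (k + g) (mcoeff k f).

Lemma translateE g f k : mcoeff k (translate g f) = mcoeff (k - g) f.
Proof.
rewrite /translate raddf_sum [in RHS](monalgE f) raddf_sum /=.
by apply: eq_bigr => l _; rewrite !mcoeffU -subr_eq0 -[in RHS]subr_eq0 opprB addrA.
Qed.

(* The direct sum L of copies of A is written additively, the group
   G = L x| Z multiplicatively. *)
Definition wreath : Type := (malg int A * int)%type.
HB.instance Definition _ := Choice.on wreath.

Definition wr_one : wreath := (0, 0).
Definition wr_mul (a b : wreath) : wreath :=
  (a.1 + translate a.2 b.1, a.2 + b.2).
Definition wr_inv (a : wreath) : wreath :=
  (- translate (- a.2) a.1, - a.2).

Fact wr_mulA : associative wr_mul.
Proof.
move=> a b c; congr pair; last by rewrite /= addrA.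
apply/malgP=> k; rewrite /= !(mcoeffD, translateE) addrA.
by congr (_ + mcoeff _ _); rewrite opprD addrA.
Qed.
Fact wr_mul1g : left_id wr_one wr_mul.
Proof.
move=> [f g]; congr pair; last by rewrite /= add0r.
by apply/malgP=> k; rewrite /= mcoeffD translateE mcoeff0 add0r subr0.
Qed.
Fact wr_mulg1 : right_id wr_one wr_mul.
Proof.
move=> [f g]; congr pair; last by rewrite /= addr0.
by apply/malgP=> k; rewrite /= mcoeffD translateE mcoeff0 addr0.
Qed.
Fact wr_mulVg : left_inverse wr_one wr_inv wr_mul.
Proof.
move=> [f g]; congr pair; last by rewrite /= addNr.
by apply/malgP=> k; rewrite /= mcoeffD mcoeffN mcoeff0 addNr.
Qed.
Fact wr_mulgV : right_inverse wr_one wr_inv wr_mul.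
Proof.
move=> [f g]; congr pair; last by rewrite /= addrN.
apply/malgP=> k; rewrite /= mcoeffD !translateE mcoeffN mcoeff0 translateE.
by rewrite opprK subrK addrN.
Qed.

HB.instance Definition _ := isGroup.Build wreath
  wr_mulA wr_mul1g wr_mulg1 wr_mulVg wr_mulgV.
End Wreath.

Definition lamp (m0 r2 t : nat) (q : 'I_t -> nat) : groupType :=
  wreath (Lam m0 r2 q).

(** * The group algebra *)

Section GroupAlgebra.
Variables (R : realType) (G : groupType).

Definition galg : lmodType R[i] := malg G R[i].

Definition U (s : G) : galg := mkmalgU s 1.

Definition galg_mul (x y : galg) : galg :=
  \sum_(s <- msupp x) \sum_(s' <- msupp y)
    (mcoeff s x * mcoeff s' y) *: U (s * s')%g.
End GroupAlgebra.

Arguments U R {G} s.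

Definition lin_span (K : pzRingType) (W : lmodType K) (S : set W) : set W :=
  [set x | exists (p : nat) (a : 'I_p -> K) (u : 'I_p -> W),
     (forall i, S (u i)) /\ x = \sum_(i < p) a i *: u i].

(** * The filtration *)

Section Filtration.
Variables (R : realType) (A : zmodType).

Fact diam_subproof (f : malg int A) :
  exists p : nat, all (fun k : int => (`|k| <= p)%N) (msupp f).
Proof.
exists (\max_(k <- msupp f) `|k|%N)%N.
by apply/allP => k kf; apply: (leq_bigmax_seq (F := fun k : int => `|k|%N)).
Qed.

Definition diam (f : malg int A) : nat := ex_minn (diam_subproof f).

Definition filt (p : nat) : set (galg R (wreath A)) :=
  lin_span [set x | exists (f : malg int A) (g : int),
    [/\ (diam f <= p)%N, (`|g| <= p)%N & x = U R ((f, g) : wreath A)]].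
End Filtration.

(** * The random matrices *)

Section RandomMatrices.
Variable R : realType.

Definition re_im (z : R[i]) : R * R := (complex.Re z, complex.Im z).

Fact two_pi_gt0 : 0 < 2 * pi :> R.
Proof. by rewrite mulr_gt0 ?pi_gt0. Qed.

Section Probability.
Context d (T : measurableType d) (P : probability T R).

Definition complex_rv (X : T -> R[i]) : Prop :=
  measurable_fun [set: T] (re_im \o X).

(* X is a random element of the unit circle whose law is the image of the
   uniform law on [0, 2 pi] under theta |-> exp (i theta). *)
Definition uniform_circle (X : T -> R[i]) : Prop :=
  [/\ complex_rv X, forall w, `|X w| = 1 &
    forall B : set (R * R), measurable B ->
      P ((re_im \o X) @^-1` B) =
      uniform_prob two_pi_gt0 ((fun theta : R => (cos theta, sin theta)) @^-1` B)].

Definition uniform_sign (X : T -> R[i]) : Prop :=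
  [/\ complex_rv X, forall w, X w = 1 \/ X w = -1,
    P (X @^-1` [set 1]) = (2^-1)%:E & P (X @^-1` [set -1]) = (2^-1)%:E].

Definition uniform_root (k : nat) (X : T -> R[i]) : Prop :=
  [/\ complex_rv X, forall w, X w ^+ k = 1 &
    forall z : R[i], z ^+ k = 1 -> P (X @^-1` [set z]) = (k%:R^-1)%:E].

Definition uniform_perm (N : nat) (V : T -> 'S_N) : Prop :=
  forall s : 'S_N, measurable (V @^-1` [set s]) /\
    P (V @^-1` [set s]) = (N`!%:R^-1)%:E.

(* Mutual independence of a finite family of systems of events. *)
Definition independent (I : finType) (F : I -> set (set T)) : Prop :=
  forall (J : {set I}) (E : I -> set T), (forall i, F i (E i)) ->
    fine (P (\bigcap_(i in [set i | i \in J]) E i)) =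
    \prod_(i in J) fine (P (E i)).

Definition sigma_perm (N : nat) (V : T -> 'S_N) : set (set T) :=
  [set V @^-1` B | B in [set: set 'S_N]].

Definition sigma_complex (X : T -> R[i]) : set (set T) :=
  [set (re_im \o X) @^-1` B | B in [set B : set (R * R) | measurable B]].

Definition complex_expectation (Z : T -> R[i]) : R[i] :=
  (fine 'E_P[fun w => complex.Re (Z w)]
    +i* fine 'E_P[fun w => complex.Im (Z w)])%C.
End Probability.

Variables (m0 r2 t : nat) (q : 'I_t -> nat).

(* [Dc j i], [Ds j i], [Dr j i] are the i-th diagonal entries of the matrices
   D_j (unit circle), D'_j (signs) and Delta_j (q_j-th roots of unity). *)
Record matrix_model (N : nat) := MatrixModel {
  disp : measure_display;
  Omega : measurableType disp;
  Pr : probability Omega R;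
  V : Omega -> 'S_N;
  Dc : 'I_m0 -> 'I_N -> Omega -> R[i];
  Ds : 'I_r2 -> 'I_N -> Omega -> R[i];
  Dr : 'I_t -> 'I_N -> Omega -> R[i];
  V_uniform : uniform_perm Pr V;
  Dc_uniform : forall j i, uniform_circle Pr (Dc j i);
  Ds_uniform : forall j i, uniform_sign Pr (Ds j i);
  Dr_uniform : forall j i, uniform_root Pr (q j) (Dr j i);
  all_independent : independent Pr
    (fun k : unit + 'I_m0 * 'I_N + 'I_r2 * 'I_N + 'I_t * 'I_N =>
       match k with
       | inl (inl (inl _)) => sigma_perm V
       | inl (inl (inr (j, i))) => sigma_complex (Dc j i)
       | inl (inr (j, i)) => sigma_complex (Ds j i)
       | inr (j, i) => sigma_complex (Dr j i)
       end)
}.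

Local Notation Lambda := (Lam m0 r2 q).
Local Notation CG := (galg R (lamp m0 r2 q)).

Section Evaluation.
Variables (N : nat) (M : matrix_model N) (w : Omega M).

Definition Vmat : 'M[R[i]]_N := perm_mx (V w).

Definition Dmat (l : Lambda) : 'M[R[i]]_N :=
  diag_mx (\row_(i < N)
    ((\prod_(j < m0) Dc j i w ^ (l.1.1 j)) *
     (\prod_(j < r2) Ds j i w ^+ (l.1.2 j)) *
     (\prod_(j < t) Dr j i w ^+ (l.2 j)))).

(* The line is the integer interval [line_lo f g, line_lo f g + line_len f g];
   its vertex k has index k - line_lo f g. *)
Definition line_lo (f : malg int Lambda) (g : int) : int :=
  \big[Num.min/0]_(k <- g :: msupp f) k.
Definition line_hi (f : malg int Lambda) (g : int) : int :=
  \big[Num.max/0]_(k <- g :: msupp f) k.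
Definition line_len (f : malg int Lambda) (g : int) : nat :=
  `|line_hi f g - line_lo f g|%N.
Definition vertex (f : malg int Lambda) (g k : int) : 'I_(line_len f g).+1 :=
  inord `|k - line_lo f g|%N.

Definition eval_monomial (f : malg int Lambda) (g : int) : 'M[R[i]]_N :=
  \matrix_(i, j)
    \sum_(phi : {ffun 'I_(line_len f g).+1 -> 'I_N} |
            (phi (vertex f g g) == i) && (phi (vertex f g 0) == j))
      (\prod_(p < line_len f g)
          Vmat (phi (lift ord0 p)) (phi (widen_ord (leqnSn _) p))) *
      (\prod_(p < (line_len f g).+1)
          Dmat (mcoeff (line_lo f g + p%:Z) f) (phi p) (phi p)).

Definition galg_eval (x : CG) : 'M[R[i]]_N :=
  \sum_(s <- msupp x) mcoeff s x *: eval_monomial s.1 s.2.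
End Evaluation.

Section Functionals.
Variable M : forall N : nat, matrix_model N.

Definition mean_trace (N : nat) (x : CG) : R[i] :=
  complex_expectation (Pr (M N)) (fun w => \tr (galg_eval w x)).

Definition Phi1 (x : CG) : R[i] :=
  limn (fun N : nat => N%:R^-1 * mean_trace N x : R[i]^o).

Definition Phi2 (x y : CG) : R[i] :=
  limn (fun N : nat => N%:R^-1 *
    complex_expectation (Pr (M N)) (fun w =>
      (\tr (galg_eval w x) - mean_trace N x) * (\tr (galg_eval w y) - mean_trace N y))
    : R[i]^o).
End Functionals.

Definition galg_shift (x : CG) (k : int) : CG :=
  galg_mul x (U R ((0, - k) : lamp m0 r2 q)).

(* The sum of the [galg_shift x k] over -r <= k <= r. *)
Definition shift_sum (x : CG) (r : nat) : CG :=
  \sum_(p < (2 * r).+1) galg_shift x (p%:Z - r%:Z).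
End RandomMatrices.

(* Main.v *)
Require Import Defs.
From HB Require Import structures.
From mathcomp Require Import all_boot all_order all_algebra all_fingroup.
From mathcomp Require Import cyclic cyclotomic separable.
From mathcomp Require Import finmap complex.
From mathcomp Require Import all_classical all_reals all_analysis.
From mathcomp Require Import measurable_realfun.
From mathcomp.multinomials Require Import -(notations) monalg.
From mathcomp Require Import zify ring lra.

(** The matrix of U_(f,g) is monomial. With s the inverse of the random
    permutation, the trace of U_(f,g) is the sum, over the points j fixed by
    s^g, of the product over k of the character f(k) of the diagonal entries of
    index s^k j ([tr_eval_monomial]). Multiplying the characters met at each
    point turns the term of j into one character of Lam^N, written
    [push s f j]. By independence its mean is 1 if [push s f j] is zero and 0
    otherwise ([mean_char_prod]), because every nontrivial power of a uniform
    variable on the circle, on the signs or on the roots of unity has mean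
    zero. All means thus count configurations: points j for one trace, pairs
    (j, j') with [push s f j + push s h j' = 0] for a product of two traces.

    On a cycle longer than the supports involved, the points s^k j are
    distinct, and then [push s f j] vanishes only for f = 0, a point is fixed
    by s^g only for g = 0, and [push s f j + push s h j' = 0] forces
    j' = s^b j with f + translate b h = 0, for a b that is unique
    ([push_match], [translate_unique]). The points on short cycles are
    negligible: their number has bounded first and second moments
    ([sum_short], [sum_short_sqr]). Dividing by N gives
    - Phi1 is the coefficient at the identity ([Phi1E]);
    - if f and h are nonzero, Phi2 (U_(f,g), U_(h,g')) is 1 if g = g' = 0 and
      f + translate b h = 0 for some b, and 0 otherwise ([Phi2E]).

    The hypothesis on x and y now says that all lamp configurations occurring
    in them are nonzero, so both formulas apply to the translates of x and y,
    and by bilinearity only a pair (f, g), (h, g') of their supports has to be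
    considered ([matched_sum]). If no b matches f with h, both sides vanish.
    Otherwise both sums over shifts have a single term, equal to 1: Phi2 selects
    the shifts by g and g', Phi1 of the product the shifts by g - b and g' + b.
    Since |b| <= n + m, the lower bounds assumed on the lengths of the two sums
    put these shifts in range. *)

Set Implicit Arguments.
Unset Strict Implicit.
Unset Printing Implicit Defensive.

Import Order.TTheory GRing.Theory Num.Theory.
Import numFieldNormedType.Exports.
Local Open Scope ring_scope.

(** * Integer powers in a finite group *)

Section IntPower.
Variable gT : finGroupType.
Implicit Types s : gT.

(** Reducing the exponent modulo the order covers negative exponents without a
    case distinction. *)
Definition zexpg s (k : int) : gT := (s ^+ `|(k %% #[s]%g)%Z|)%g.

Lemma zexpg_nat s (n : nat) : zexpg s n = (s ^+ n)%g.
Proof. by rewrite /zexpg modz_nat expg_mod_order. Qed.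

Lemma zexpg0 s : zexpg s 0 = 1%g.
Proof. by rewrite (zexpg_nat s 0) expg0. Qed.

Lemma zexpg1 s : zexpg s 1 = s.
Proof. by rewrite (zexpg_nat s 1) expg1. Qed.

Lemma zexpgD s k l : zexpg s (k + l) = (zexpg s k * zexpg s l)%g.
Proof.
rewrite /zexpg -expgD; apply/eqP; rewrite eq_expg_mod_order.
have o0 : (#[s]%g : int) != 0 by have := order_gt0 s; lia.
rewrite -eqz_nat -!modz_nat PoszD !gez0_abs ?modz_ge0 //.
by rewrite modz_mod modzDml modzDmr.
Qed.
End IntPower.

Section PermWalk.
Variable T : finType.
Implicit Types (s : {perm T}) (x y : T).

Lemma zexpg_permD s k l x : zexpg s (k + l) x = zexpg s l (zexpg s k x).
Proof. by rewrite zexpgD permM. Qed.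

Lemma zexpgK s k x : zexpg s (- k) (zexpg s k x) = x.
Proof. by rewrite -zexpg_permD subrr zexpg0 perm1. Qed.

Lemma zexpg_porbit s k x : zexpg s k x \in porbit s x.
Proof. exact: mem_porbit. Qed.

Lemma card_porbit_zexpg s k x : #|porbit s (zexpg s k x)| = #|porbit s x|.
Proof. by congr #|pred_of_set _|; apply/eqP; rewrite eq_porbit_mem zexpg_porbit. Qed.

Lemma card_porbit_fixed s (d : int) x :
  d != 0 -> zexpg s d x = x -> (#|porbit s x| <= `|d|)%N.
Proof.
move=> d0 fx; have {fx} fx : (s ^+ `|d|)%g x = x.
  case: (ltP d 0) => hd; last by rewrite -zexpg_nat gez0_abs.
  rewrite -zexpg_nat ltz0_abs // -[in LHS]fx -zexpg_permD subrr.
  by rewrite zexpg0 perm1.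
rewrite leqNgt; apply/negP => lt_d.
have d_gt0 : (0 < `|d|)%N by rewrite absz_gt0.
have := nth_uniq x _ _ (uniq_traject_porbit s x).
rewrite size_traject => /(_ _ _ lt_d (ltn_trans d_gt0 lt_d)).
rewrite !nth_traject ?(ltn_trans d_gt0) //= -permX fx eqxx => /esym/eqP d00.
by rewrite d00 in d_gt0.
Qed.
End PermWalk.

(** * Points of a uniform permutation on short cycles *)
Section ShortCycles.
Import boot.fintype boot.finset.
Local Open Scope nat_scope.

Lemma mul_sub_half N c a b : 2 * c <= N -> a * (N - c) <= b -> N * a <= 2 * b.
Proof.
move=> cN h; apply: (@leq_trans (2 * (N - c) * a)).
  by rewrite leq_mul2r; apply/orP; right; lia.
by rewrite -mulnA leq_mul2l /= mulnC.
Qed.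

Variable T : finType.
Implicit Types (s : {perm T}) (x y i : T).

Definition short K s : {set T} := [set x | #|porbit s x| <= K].

(** In [tperm x i * s] the point [i] has taken the place of [x]: its orbit runs
    once through the cycle of [x] and then leaves it. *)
Lemma merge_iter s x i k :
  i \notin porbit s x -> 0 < k <= #|porbit s x| ->
  ((tperm x i * s) ^+ k)%g i = (s ^+ k)%g x.
Proof.
move=> iNx; elim: k => [//|[|k] IH] /andP[_ hk].
  by rewrite !expg1 permM tpermR.
rewrite expgSr permM IH ?(ltnW hk) // permM tpermD.
- by rewrite [in RHS]expgSr permM.
- apply/eqP => e; have := nth_uniq x (i := 0) (j := k.+1) _ _ (uniq_traject_porbit s x).
  rewrite size_traject hk (leq_ltn_trans _ hk) // => /(_ isT isT).
  by rewrite !nth_traject // ?(leq_ltn_trans _ hk) //= -iterS -permX -e eqxx.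
- by apply: contraNneq iNx => ->; exact: mem_porbit.
Qed.

Lemma merge_porbit s x y i :
  y \notin porbit s x -> i \notin porbit s y ->
  porbit (tperm x i * s)%g y = porbit s y.
Proof.
move=> yNx iNy.
have iterE k : ((tperm x i * s) ^+ k)%g y = (s ^+ k)%g y.
  elim: k => [|k IH]; first by rewrite !expg0.
  rewrite expgSr permM IH permM tpermD.
  - by rewrite [in RHS]expgSr permM.
  - apply: contraNneq yNx => ->; by rewrite porbit_sym mem_porbit.
  - by apply: contraNneq iNy => ->; exact: mem_porbit.
apply/setP => z; apply/porbitP/porbitP => -[k ->]; exists k; by rewrite iterE.
Qed.

(** Multiplying by the transposition of [x] with a point outside its cycle
    inserts this cycle into another one. The new permutation and the length of
    the old cycle determine the point, hence the old permutation, so a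
    permutation with a short cycle through [x] has about [#|T|] distinct
    images. *)
Lemma merge_count K c x (A B : {set {perm T}}) (D : {perm T} -> {set T}) :
  {in A, forall s, [/\ #|porbit s x| <= K, #|T| - c <= #|D s| &
    {in D s, forall i, i \notin porbit s x /\ (tperm x i * s)%g \in B}]} ->
  #|A| * (#|T| - c) <= K * #|B|.
Proof.
move=> hA.
pose P := [set p : {perm T} * T | (p.1 \in A) && (p.2 \in D p.1)].
have len_lt s : s \in A -> #|porbit s x| < K.+1 by move=> /hA[].
pose h (p : {perm T} * T) : 'I_K.+1 * {perm T} :=
  (inord #|porbit p.1 x|, (tperm x p.2 * p.1)%g).
have h_inj : {in P &, injective h}.
  move=> [s i] [s' i']; rewrite !inE /= => /andP[sA iD] /andP[sA' iD'] [].
  move=> /(congr1 val); rewrite /= !inordK ?len_lt // => el es.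
  have [_ _ /(_ i iD) [iN _]] := hA s sA.
  have [_ _ /(_ i' iD') [iN' _]] := hA s' sA'.
  have lt0 (u : {perm T}) : 0 < #|porbit u x|.
    by apply/card_gt0P; exists x; exact: porbit_id.
  have ei : i = i'.
    apply: (@perm_inj _ ((tperm x i * s) ^+ #|porbit s x|)%g).
    rewrite merge_iter ?lt0 ?leqnn // es el merge_iter ?lt0 ?leqnn //.
    by rewrite !permX -{1}el !iter_porbit.
  by move: es; rewrite ei => /mulgI ->.
have sub : h @: P \subset setX (~: [set ord0]) B.
  apply/subsetP => _ /imsetP[[s i] + ->]; rewrite !inE /= => /andP[sA iD].
  have [_ _ /(_ i iD) [_ ->]] := hA s sA; rewrite andbT -val_eqE /= inordK ?len_lt //.
  by rewrite -lt0n; apply/card_gt0P; exists x; exact: porbit_id.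
have := subset_leq_card sub; rewrite card_in_imset // cardsX cardsC1 card_ord.
apply: leq_trans.
have -> : #|P| = \sum_(s in A) #|D s|.
  under [RHS]eq_bigr do rewrite -sum1_card.
  by rewrite pair_big_dep /= -sum1_card; apply: eq_bigl => p; rewrite inE.
rewrite -sum_nat_const; apply: leq_sum => s sA.
by have [] := hA s sA.
Qed.

Definition short_at K x := [set s : {perm T} | x \in short K s].

Lemma short_at_count K x : #|short_at K x| * (#|T| - K) <= K * (#|T|)`!.
Proof.
have -> : (#|T|)`! = #|[set: {perm T}]|.
  rewrite -[in LHS]cardsT -card_perm; apply: eq_card => s.
  by rewrite [RHS]inE; apply/subsetP => z _; exact: in_setT.
apply: (@merge_count K K x _ _ (fun s => ~: porbit s x)) => s; rewrite !inE => hs.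
split=> // [|i]; last by rewrite !inE.
by rewrite cardsCs setCK; lia.
Qed.

(** Merging the cycle of [x] with a point away from the cycle of [y] leaves the
    latter as it is. *)
Lemma short_at2_count K x y :
  #|[set s in short_at K x | (s \in short_at K y) && (y \notin porbit s x)]|
    * (#|T| - 2 * K) <= K * #|short_at K y|.
Proof.
apply: (@merge_count K _ x _ _ (fun s => ~: (porbit s x :|: porbit s y))) => s.
rewrite !inE => /and3P[hx hy yNx]; split=> // [|i].
  have := cardsUI (porbit s x) (porbit s y); have := max_card (porbit s x :|: porbit s y).
  by move=> hm hU; rewrite cardsCs setCK; lia.
rewrite !inE negb_or => /andP[iNx iNy]; split=> //.
by rewrite merge_porbit.
Qed.

Lemma sum_short_at K :
  \sum_(s : {perm T}) #|short K s| = \sum_x #|short_at K x|.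
Proof.
under eq_bigr do rewrite -sum1_card big_mkcond.
rewrite exchange_big; apply: eq_bigr => x _; rewrite -big_mkcond /= -sum1_card.
by apply: eq_bigl => s; rewrite !inE.
Qed.

Lemma sum_short K : 0 < #|T| -> 2 * K <= #|T| ->
  \sum_(s : {perm T}) #|short K s| <= 2 * K * (#|T|)`!.
Proof.
move=> T0 hK.
rewrite sum_short_at -(leq_pmul2l T0) big_distrr /= -sum_nat_const; apply: leq_sum => x _.
by rewrite -mulnA; apply: mul_sub_half (short_at_count K x).
Qed.

(** The pairs on a common cycle are at most [K] times as many as the short
    points; those on two cycles are estimated by merging one cycle after the
    other. *)
Lemma sum_short_sqr K : 0 < #|T| -> 4 * K <= #|T| ->
  \sum_(s : {perm T}) #|short K s| ^ 2 <= 6 * K ^ 2 * (#|T|)`!.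
Proof.
move=> T0 hK.
have -> : 6 * K ^ 2 * (#|T|)`! = K * (2 * K * (#|T|)`!) + 2 * K * (2 * K * (#|T|)`!) by nia.
have S1 : \sum_(s : {perm T}) #|short K s| <= 2 * K * (#|T|)`! by apply: sum_short => //; lia.
pose far x y := #|[set s in short_at K x | (s \in short_at K y) && (y \notin porbit s x)]|.
(* The partner of a short point [x] is on its cycle or far from it. *)
have split_sqr : \sum_(s : {perm T}) #|short K s| ^ 2 <=
    \sum_(s : {perm T}) K * #|short K s| + \sum_x \sum_y far x y.
  have -> : \sum_x \sum_y far x y =
      \sum_(s : {perm T}) \sum_(x in short K s) #|[set y in short K s | y \notin porbit s x]|.
    under eq_bigr => x _ do under eq_bigr => y _ do
      rewrite /far -sum1_card big_mkcond.
    under eq_bigr do rewrite exchange_big.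
    rewrite exchange_big; apply: eq_bigr => s _; rewrite [RHS]big_mkcond /=.
    apply: eq_bigr => x _; case: ifPn => hx; last first.
      by rewrite big1 // => y _; rewrite !inE in hx *; rewrite (negbTE hx).
    rewrite -sum1_card [RHS]big_mkcond; apply: eq_bigr => y _.
    by rewrite !inE in hx *; rewrite hx.
  rewrite -big_split /=; apply: leq_sum => s _.
  rewrite expnS expn1 -[K * _]mulnC -sum_nat_const -sum_nat_const -big_split /=.
  apply: leq_sum => x; rewrite inE => hx.
  rewrite -(cardsID (porbit s x) (short K s)) leq_add //.
    by apply: leq_trans hx; apply: subset_leq_card; exact: subsetIr.
  by apply: subset_leq_card; apply/subsetP => y; rewrite !inE andbC.
apply: leq_trans split_sqr _; apply: leq_add.
  by rewrite -big_distrr leq_mul2l S1 orbT.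
have -> : \sum_x \sum_y far x y = \sum_y \sum_x far x y by rewrite exchange_big.
apply: (@leq_trans (\sum_y 2 * K * #|short_at K y|)); last first.
  by rewrite -big_distrr leq_mul2l /= -sum_short_at S1 orbT.
apply: leq_sum => y _.
rewrite -(leq_pmul2l T0) big_distrr /= -sum_nat_const; apply: leq_sum => x _.
rewrite -mulnA; apply: mul_sub_half (short_at2_count K x y).
by rewrite mulnA.
Qed.
End ShortCycles.

(** * Lamp configurations carried along a cycle *)
Section Push.
Import boot.fintype boot.finset.
Variables (A : zmodType) (T : finType).
Implicit Types (s : {perm T}) (x y : T) (f h : malg int A).

Definition spike (a : A) (y : T) : {ffun T -> A} := [ffun z => a *+ (y == z)].

Fact spike0 y : spike 0 y = 0.
Proof. by apply/ffunP => z; rewrite !ffunE mul0rn. Qed.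

Fact spikeD y : {morph spike^~ y : a b / a + b}.
Proof. by move=> a b; apply/ffunP => z; rewrite !ffunE mulrnDl. Qed.

(** The configuration [f] read along the orbit of [x]: its lamp at [k] is carried
    to [s^k x], and lamps that meet at a point add up. *)
Definition push s f x : {ffun T -> A} :=
  \sum_(k <- msupp f) spike (mcoeff k f) (zexpg s k x).

Lemma pushEw s f x (d : {fset int}) : (msupp f `<=` d)%fset ->
  push s f x = \sum_(k <- d) spike (mcoeff k f) (zexpg s k x).
Proof.
move=> le; rewrite /push (big_fset_incl _ le) //= => k _ kf.
by rewrite mcoeff_outdom // spike0.
Qed.

Lemma pushD s f h x : push s (f + h) x = push s f x + push s h x.
Proof.
rewrite !(@pushEw s _ x (msupp f `|` msupp h)%fset) ?fsubsetUl ?fsubsetUr //.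
  by rewrite -big_split; apply: eq_bigr => k _; rewrite mcoeffD spikeD.
exact: msuppD_le.
Qed.

Lemma push0 s x : push s 0 x = 0.
Proof. by rewrite /push msupp0 big_seq_fset0. Qed.

Lemma pushU s k a x : push s (mkmalgU k a) x = spike a (zexpg s k x).
Proof.
by rewrite (pushEw _ _ (@msuppU_le _ _ k a)) big_seq_fset1 mcoeffUU.
Qed.

Lemma push_translate s b f x : push s (translate b f) x = push s f (zexpg s b x).
Proof.
rewrite /translate (big_morph (fun h => push s h x) (fun h h' => pushD s h h' x) (push0 s x)).
by apply: eq_bigr => k _; rewrite pushU addrC zexpg_permD.
Qed.

Lemma push_neq0 s f x y : push s f x y != 0 ->
  exists2 k, k \in msupp f & y = zexpg s k x.
Proof.
move=> nz; have [[k kf ->]|no] := pselect (exists2 k, k \in msupp f & y = zexpg s k x).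
  by exists k.
case/negP: nz; rewrite sum_ffunE big_seq big1 // => k kf; rewrite ffunE.
by case: eqP => // e; case: no; exists k.
Qed.

Definition supp_within (W : nat) f := forall k, k \in msupp f -> (`|k| <= W)%N.

(** On a cycle longer than the support, distinct lamps sit at distinct points. *)
Lemma push_lamp s f x W k : supp_within W f -> (2 * W < #|porbit s x|)%N ->
  (`|k| <= W)%N -> push s f x (zexpg s k x) = mcoeff k f.
Proof.
move=> fW lt_W kW; rewrite sum_ffunE.
have off l : l \in msupp f -> l != k -> zexpg s l x != zexpg s k x.
  move=> lf lk; apply/eqP => e.
  have fx : zexpg s (l - k) x = x by rewrite zexpg_permD e zexpgK.
  have lW := fW l lf; have := card_porbit_fixed _ fx; rewrite subr_eq0 lk => /(_ isT).
  lia.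
case: (boolP (k \in msupp f)) => kf; last first.
  rewrite mcoeff_outdom // big_seq big1 // => l lf; rewrite ffunE.
  by rewrite (negbTE (off l lf _)) //; apply: contraNneq kf => <-.
rewrite (big_fsetD1 k) //= ffunE eqxx mulr1n big_seq big1 ?addr0 // => l.
by rewrite in_fsetD1 => /andP[lk lf]; rewrite ffunE (negbTE (off l lf lk)).
Qed.

Lemma push_inj s f x W : supp_within W f -> (2 * W < #|porbit s x|)%N ->
  push s f x = 0 -> f = 0.
Proof.
move=> fW lt_W p0; apply/malgP => k; rewrite mcoeff0.
case: (boolP (k \in msupp f)) => [kf|/mcoeff_outdom //].
by rewrite -(push_lamp fW lt_W (fW k kf)) p0 ffunE.
Qed.

Lemma supp_within_translate W f b : supp_within W f -> supp_within (W + `|b|) (translate b f).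
Proof.
move=> fW k; rewrite -mcoeff_neq0 translateE mcoeff_neq0 => /fW; lia.
Qed.

Lemma supp_withinD W f h : supp_within W f -> supp_within W h -> supp_within W (f + h).
Proof.
by move=> fW hW k /(fsubsetP (msuppD_le f h)); rewrite in_fsetU => /orP[/fW|/hW].
Qed.

Lemma supp_withinW W W' f : (W <= W')%N -> supp_within W f -> supp_within W' f.
Proof. by move=> le fW k /fW /leq_trans; apply. Qed.

Lemma malg_neq0P f : f != 0 -> exists k, k \in msupp f.
Proof.
move=> f0; apply: contrapT => no; move/eqP: f0; apply; apply/malgP => k.
by rewrite mcoeff0; apply/mcoeff_outdom/negP => kf; apply: no; exists k.
Qed.

(** A lamp of [f] has to be cancelled by a lamp of [h]. Hence [y] is on the cycle
    of [x], at a distance [b] bounded by the supports, and the sum is the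
    configuration [f + translate b h] read from [x]. *)
Lemma push_match s f h x y W W' : f != 0 -> supp_within W f -> supp_within W' h ->
  (4 * (W + W') < #|porbit s x|)%N -> push s f x + push s h y = 0 ->
  exists2 b, y = zexpg s b x & f + translate b h = 0.
Proof.
move=> f0 fW hW lt_W p0.
have [k kf] := malg_neq0P f0.
have lt_W' : (2 * W < #|porbit s x|)%N by lia.
have nz : push s h y (zexpg s k x) != 0.
  have/ffunP/(_ (zexpg s k x)) := p0.
  rewrite !ffunE (push_lamp fW lt_W' (fW k kf)) => /eqP.
  by rewrite addrC addr_eq0 => /eqP ->; rewrite oppr_eq0 mcoeff_neq0.
have [l lh e] := push_neq0 nz.
have ey : y = zexpg s (k - l) x by rewrite zexpg_permD e zexpgK.
exists (k - l) => //; apply: (@push_inj s _ x (2 * (W + W'))).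
- apply: supp_withinD; first by apply: (supp_withinW _ fW); lia.
  apply: (supp_withinW _ (supp_within_translate (b := k - l) hW)).
  by have := fW k kf; have := hW l lh; lia.
- by lia.
- by rewrite pushD push_translate -ey.
Qed.

(** The points, and the pairs of points, that contribute to the mean of the
    trace of a monomial and of the product of two traces. *)
Definition fixed_set s f g : {set T} :=
  [set x | (zexpg s g x == x) && (push s f x == 0)].

Definition matched_pairs s f g h g' : {set T * T} :=
  [set p | [&& zexpg s g p.1 == p.1, zexpg s g' p.2 == p.2
             & push s f p.1 + push s h p.2 == 0]].

Lemma fixed_set_one s : #|fixed_set s 0 0| = #|T|.
Proof.
by rewrite -[RHS]cardsT; apply: eq_card => x; rewrite !inE zexpg0 perm1 push0 !eqxx.
Qed.

Lemma fixed_set_short s f g W K : (f != 0) || (g != 0) -> supp_within W f ->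
  (2 * W + `|g| <= K)%N -> fixed_set s f g \subset short K s.
Proof.
move=> fg fW hK; apply/subsetP => x; rewrite !inE => /andP[/eqP gx /eqP p0].
case: (boolP (g == 0)) fg => [_|g0 _]; last first.
  by apply: leq_trans (card_porbit_fixed g0 gx) _; lia.
rewrite orbF => f0; rewrite leqNgt; apply: contra f0 => lt_K.
by apply/eqP/(push_inj fW _ p0); lia.
Qed.

(** A nonzero finitely supported function has no period. *)
Lemma translate_unique f h W b b' : h != 0 -> supp_within W h ->
  f + translate b h = 0 -> f + translate b' h = 0 -> b = b'.
Proof.
move=> h0 hW e e'; have {e e'} e k : mcoeff (k - b) h = mcoeff (k - b') h.
  rewrite -!translateE; congr mcoeff; apply: (addrI f); by rewrite e e'.
have iter_e n k : mcoeff (k + (b - b') *+ n) h = mcoeff k h.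
  elim: n => [|n IH]; first by rewrite mulr0n addr0.
  rewrite mulrSr -[RHS]IH; have := e (k + (b - b') *+ n + b); rewrite addrK => ->.
  by congr (mcoeff _ h); rewrite !addrA.
have [k kh] := malg_neq0P h0.
apply/eqP; rewrite -subr_eq0; apply/negPn/negP => bb.
(* [2 * W + 1] periods leave the interval from [- W] to [W]. *)
have := kh; rewrite -mcoeff_neq0 -(iter_e (2 * W).+1) mcoeff_neq0 => /hW.
have := hW k kh; rewrite -mulr_natr; nia.
Qed.

Section Matching.
Variables (f h : malg int A) (g g' : int) (W W' K : nat).
Hypotheses (f0 : f != 0) (h0 : h != 0) (fW : supp_within W f) (hW : supp_within W' h).
(* On cycles longer than [K], lamps stay apart and nonzero powers [g], [g'] fix
   no point. *)
Hypothesis hK : (4 * (W + W') + `|g| + `|g'| <= K)%N.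

(** A point on a long cycle has its partner on the same cycle. *)
Lemma matched_pairs_short s x y : (x, y) \in matched_pairs s f g h g' ->
  (x \in short K s) = (y \in short K s).
Proof.
rewrite !inE /= => /and3P[_ _ /eqP p0]; rewrite leqNgt [RHS]leqNgt; congr negb.
apply/idP/idP => lt_K.
  have [|b -> _] := push_match f0 fW hW _ p0; first by lia.
  by rewrite card_porbit_zexpg.
rewrite addrC in p0; have [|b -> _] := push_match h0 hW fW _ p0; first by lia.
by rewrite card_porbit_zexpg.
Qed.

Lemma matched_pairs_long s x y : (x, y) \in matched_pairs s f g h g' ->
  x \notin short K s ->
  [/\ g = 0, g' = 0 & exists2 b, y = zexpg s b x & f + translate b h = 0].
Proof.
move=> xy xN; have yN := xN; rewrite (matched_pairs_short xy) in yN.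
move: xy xN yN; rewrite !inE -!ltnNge /= => /and3P[/eqP gx /eqP gy /eqP p0] xN yN.
split.
- by apply/eqP; apply: contraTT xN => /card_porbit_fixed/(_ gx); lia.
- by apply/eqP; apply: contraTT yN => /card_porbit_fixed/(_ gy); lia.
- by apply: push_match f0 fW hW _ p0; apply: leq_ltn_trans xN; lia.
Qed.

Lemma card_matched_pairs_miss s :
  ~ [/\ g = 0, g' = 0 & exists b, f + translate b h = 0] ->
  (#|matched_pairs s f g h g'| <= #|short K s| ^ 2)%N.
Proof.
move=> no; rewrite expnS expn1 -cardsX; apply: subset_leq_card.
apply/subsetP => -[x y] xy; rewrite in_setX -(matched_pairs_short xy) andbb.
apply/negPn/negP => /(matched_pairs_long xy)[? ? [b _ ?]].
by apply: no; split=> //; exists b.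
Qed.

Lemma card_matched_pairs_hit s b : g = 0 -> g' = 0 -> f + translate b h = 0 ->
  (#|T| <= #|matched_pairs s f g h g'| + #|short K s|)%N /\
  (#|matched_pairs s f g h g'| <= #|T| + #|short K s| ^ 2)%N.
Proof.
move=> g0 g'0 e; pose d x := (x, zexpg s b x).
have d_inj : injective d by move=> x y [].
have dM x : d x \in matched_pairs s f g h g'.
  by rewrite !inE g0 g'0 !zexpg0 !perm1 !eqxx -push_translate -pushD e push0 /=.
split.
  have : (#|d @: [set: T]| <= #|matched_pairs s f g h g'|)%N.
    by apply: subset_leq_card; apply/subsetP => _ /imsetP[x _ ->].
  by rewrite card_imset // cardsT => /leq_trans; apply; exact: leq_addr.
have sub : matched_pairs s f g h g' \subset d @: [set: T] :|: setX (short K s) (short K s).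
  apply/subsetP => -[x y] xy; rewrite inE in_setX -(matched_pairs_short xy) andbb.
  case: (boolP (x \in short K s)) => [|xN]; first by rewrite orbT.
  have [_ _ [b' -> e']] := matched_pairs_long xy xN.
  by rewrite (translate_unique h0 hW e' e) imset_f.
apply: leq_trans (subset_leq_card sub) _; apply: leq_trans (leq_card_setU _ _) _.
by rewrite card_imset // cardsT cardsX expnS expn1.
Qed.
End Matching.
End Push.

Local Open Scope classical_set_scope.
Local Open Scope ring_scope.

(** * Bounded complex random variables *)
Section ComplexNorm.
Variable R : realType.
Implicit Types (z : R[i]) (e : R).

Lemma normc_le_ReIm z e : `|z| <= e%:C%C ->
  `|complex.Re z| <= e /\ `|complex.Im z| <= e.
Proof.
move=> ze; split; rewrite -lecR; first exact: le_trans (normc_ge_Re z) ze.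
have <- : complex.Re (- 'i * z) = complex.Im z.
  by rewrite -complexiE; case: z {ze} => a b /=; ring.
by apply: le_trans (normc_ge_Re _) _; rewrite normrM normrN normCi mul1r.
Qed.

Lemma normc_ReIm_le z e : `|complex.Re z| <= e -> `|complex.Im z| <= e ->
  `|z| <= (e *+ 2)%:C%C.
Proof.
move=> re im; rewrite [z]complexE; apply: le_trans (ler_normD _ _) _.
rewrite normrM complexiE normCi mul1r !normc_def /= expr0n /= addr0 addr0 !sqrtr_sqr.
by rewrite -rmorphD lecR mulr2n lerD.
Qed.
End ComplexNorm.

Section ComplexExpectation.
Context d (T : measurableType d) (R : realType) (P : probability T R).
Implicit Types (X Y : T -> R) (Z W : T -> R[i]).

Definition cmeasurable d' (T' : measurableType d') (Z : T' -> R[i]) : Prop :=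
  measurable_fun [set: T'] (@complex.Re R \o Z) /\
  measurable_fun [set: T'] (@complex.Im R \o Z).

Definition cbounded (Z : T -> R[i]) : Prop :=
  cmeasurable Z /\ exists M : R, forall w, `|Z w| <= M%:C%C.

Local Notation E := (complex_expectation P).

Section Measurable.
Context d' (T' : measurableType d').
Implicit Types (F G : T' -> R[i]).

Lemma cmeasurable_cst (c : R[i]) : cmeasurable ((fun=> c) : T' -> R[i]).
Proof. by split; exact: measurable_cst. Qed.

Lemma cmeasurableD F G : cmeasurable F -> cmeasurable G ->
  cmeasurable (fun x => F x + G x).
Proof.
move=> [rF iF] [rG iG]; split.
  rewrite (_ : _ \o _ = (@complex.Re R \o F) \+ (@complex.Re R \o G)).
    exact: measurable_funD.
  by apply/funext => x /=; case: (F x) (G x) => [? ?] [].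
rewrite (_ : _ \o _ = (@complex.Im R \o F) \+ (@complex.Im R \o G)).
  exact: measurable_funD.
by apply/funext => x /=; case: (F x) (G x) => [? ?] [].
Qed.

Lemma cmeasurableM F G : cmeasurable F -> cmeasurable G ->
  cmeasurable (fun x => F x * G x).
Proof.
move=> [rF iF] [rG iG]; split.
  rewrite (_ : _ \o _ = ((@complex.Re R \o F) \* (@complex.Re R \o G)) \-
                        ((@complex.Im R \o F) \* (@complex.Im R \o G))).
    by apply: measurable_funB; exact: measurable_funM.
  by apply/funext => x /=; case: (F x) (G x) => [? ?] [].
rewrite (_ : _ \o _ = ((@complex.Re R \o F) \* (@complex.Im R \o G)) \+
                      ((@complex.Im R \o F) \* (@complex.Re R \o G))).
  by apply: measurable_funD; exact: measurable_funM.
by apply/funext => x /=; case: (F x) (G x) => [? ?] [].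
Qed.

Lemma cmeasurableX F n : cmeasurable F -> cmeasurable (fun x => F x ^+ n).
Proof.
move=> mF; elim: n => [|n IH].
  by under eq_fun do rewrite expr0; exact: cmeasurable_cst.
by under eq_fun do rewrite exprS; exact: cmeasurableM.
Qed.
End Measurable.

Lemma cbounded_cst (c : R[i]) : cbounded (fun=> c).
Proof.
split; first exact: cmeasurable_cst.
exists (complex.Re `|c|) => w.
by rewrite RRe_real ?normr_real.
Qed.

Lemma cboundedD Z W : cbounded Z -> cbounded W -> cbounded (fun w => Z w + W w).
Proof.
move=> [mZ [M ZM]] [mW [N WN]]; split; first exact: cmeasurableD.
exists (M + N) => w; rewrite rmorphD.
by apply: le_trans (ler_normD _ _) _; exact: lerD.
Qed.

Lemma cboundedM Z W : cbounded Z -> cbounded W -> cbounded (fun w => Z w * W w).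
Proof.
move=> [mZ [M ZM]] [mW [N WN]]; split; first exact: cmeasurableM.
by exists (M * N) => w; rewrite rmorphM normrM ler_pM.
Qed.

Lemma cboundedZ c Z : cbounded Z -> cbounded (fun w => c * Z w).
Proof. by apply: cboundedM; exact: cbounded_cst. Qed.

Lemma cboundedN Z : cbounded Z -> cbounded (fun w => - Z w).
Proof. by under [X in _ -> cbounded X]eq_fun do rewrite -mulN1r; exact: cboundedZ. Qed.

Lemma cboundedB Z W : cbounded Z -> cbounded W -> cbounded (fun w => Z w - W w).
Proof. by move=> bZ bW; apply: cboundedD => //; exact: cboundedN. Qed.

Lemma cbounded_sum (I : Type) (r : seq I) (Q : pred I) (Z : I -> T -> R[i]) :
  (forall i, Q i -> cbounded (Z i)) -> cbounded (fun w => \sum_(i <- r | Q i) Z i w).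
Proof.
move=> bZ; elim: r => [|i r IH].
  by under eq_fun do rewrite big_nil; exact: cbounded_cst.
under eq_fun do rewrite big_cons; case: (boolP (Q i)) => // Qi.
by apply: cboundedD => //; exact: bZ.
Qed.

Lemma cbounded_prod (I : Type) (r : seq I) (Q : pred I) (Z : I -> T -> R[i]) :
  (forall i, Q i -> cbounded (Z i)) -> cbounded (fun w => \prod_(i <- r | Q i) Z i w).
Proof.
move=> bZ; elim: r => [|i r IH].
  by under eq_fun do rewrite big_nil; exact: cbounded_cst.
under eq_fun do rewrite big_cons; case: (boolP (Q i)) => // Qi.
by apply: cboundedM => //; exact: bZ.
Qed.

Lemma bounded_integrable X (M : R) : measurable_fun [set: T] X ->
  (forall w, `|X w| <= M) -> P.-integrable [set: T] (EFin \o X).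
Proof.
move=> mX XM; apply: measurable_bounded_integrable => //.
  by apply: le_lt_trans (probability_le1 P measurableT) _; rewrite ltry.
exists M; split; first by rewrite realE; case: (lerP 0 M) => //= /ltW ->.
by move=> y My w _; apply: le_trans (XM w) (ltW My).
Qed.

Lemma cbounded_integrable Z : cbounded Z ->
  P.-integrable [set: T] (EFin \o (fun w => complex.Re (Z w))) /\
  P.-integrable [set: T] (EFin \o (fun w => complex.Im (Z w))).
Proof.
move=> [[mre mim] [M ZM]]; split; apply: (@bounded_integrable _ M) => // w;
  by have [] := normc_le_ReIm (ZM w).
Qed.

Lemma Rintegral_prob_cst (a : R) : Rintegral P [set: T] (fun=> a) = a.
Proof.
rewrite Rintegral_cst // (_ : fine _ = 1) ?mulr1 //.
by rewrite (_ : _ [set: T] = 1%E) //; exact: probability_setT.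
Qed.

Lemma cexpectationE Z :
  E Z = (Rintegral P [set: T] (fun w => complex.Re (Z w))
    +i* Rintegral P [set: T] (fun w => complex.Im (Z w)))%C.
Proof. by rewrite /complex_expectation unlock. Qed.

Lemma eq_cexpectation Z W : Z =1 W -> E Z = E W.
Proof. by move=> /funext ->. Qed.

Lemma cexpectationD Z W : cbounded Z -> cbounded W ->
  E (fun w => Z w + W w) = E Z + E W.
Proof.
move=> /cbounded_integrable[rZ iZ] /cbounded_integrable[rW iW].
rewrite !cexpectationE; simpc; congr Complex; rewrite -RintegralD //;
  by apply: eq_Rintegral => w _; case: (Z w) (W w) => [? ?] [].
Qed.

Lemma cexpectationZ c Z : cbounded Z -> E (fun w => c * Z w) = c * E Z.
Proof.
move=> bZ; have [rZ iZ] := cbounded_integrable bZ.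
have ZI (a : R) (X : T -> R) : P.-integrable [set: T] (EFin \o X) ->
    P.-integrable [set: T] (EFin \o (fun w => a * X w)).
  by move=> iX; under [X in _.-integrable _ X]eq_fun do rewrite /= EFinM; exact: integrableZl.
rewrite !cexpectationE; case: c => a b; simpc; congr Complex.
  rewrite -!RintegralZl // -RintegralB //; try exact: ZI.
  by apply: eq_Rintegral => w _; case: (Z w).
rewrite -!RintegralZl // -RintegralD //; try exact: ZI.
by apply: eq_Rintegral => w _; case: (Z w).
Qed.

Lemma cexpectation_cst c : E (fun=> c) = c.
Proof.
by rewrite cexpectationE !Rintegral_prob_cst; case: c.
Qed.

Lemma cexpectationB Z W : cbounded Z -> cbounded W ->
  E (fun w => Z w - W w) = E Z - E W.
Proof.
move=> bZ bW; rewrite cexpectationD //; last exact: cboundedN.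
by congr (_ + _); under eq_fun do rewrite -mulN1r; rewrite cexpectationZ // mulN1r.
Qed.

Lemma cexpectation_sum (I : Type) (r : seq I) (Q : pred I) (Z : I -> T -> R[i]) :
  (forall i, Q i -> cbounded (Z i)) ->
  E (fun w => \sum_(i <- r | Q i) Z i w) = \sum_(i <- r | Q i) E (Z i).
Proof.
move=> bZ; elim: r => [|i r IH].
  by under eq_fun do rewrite big_nil; rewrite cexpectation_cst big_nil.
under eq_fun do rewrite big_cons; rewrite big_cons; case: (boolP (Q i)) => // Qi.
by rewrite cexpectationD ?IH //; [exact: bZ | exact: cbounded_sum].
Qed.

Lemma norm_cexpectation_le Z (e : R) : cbounded Z -> (forall w, `|Z w| <= e%:C%C) ->
  `|E Z| <= (e *+ 2)%:C%C.
Proof.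
move=> bZ Ze; have [rZ iZ] := cbounded_integrable bZ.
have bound X : P.-integrable [set: T] (EFin \o X) -> (forall w, `|X w| <= e) ->
    `|Rintegral P [set: T] X| <= e.
  move=> iX Xe; apply: le_trans (le_normr_Rintegral _ iX) _ => //.
  rewrite -[leRHS]Rintegral_prob_cst; apply: le_Rintegral => //.
    exact: (integrable_norm iX).
  apply: (@bounded_integrable _ `|e|) => //; exact: measurable_cst.
rewrite cexpectationE; apply: normc_ReIm_le => /=; apply: bound => // w;
  by have [] := normc_le_ReIm (Ze w).
Qed.

Definition cindic (A : set T) (w : T) : R[i] := (\1_A w)%:C%C.

Lemma cindicE A w : cindic A w = (w \in A)%:R.
Proof. by rewrite /cindic indicE; case: (_ \in _). Qed.

Lemma cbounded_indic A : measurable A -> cbounded (cindic A).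
Proof.
move=> mA; split; first by split; [exact: measurable_indic | exact: measurable_cst].
by exists 1 => w; rewrite cindicE normr_nat; case: (_ \in _).
Qed.

Lemma cexpectation_indic A : measurable A -> E (cindic A) = (fine (P A))%:C%C.
Proof.
move=> mA; rewrite cexpectationE /= Rintegral_prob_cst; congr Complex.
by rewrite /Rintegral integral_indic // setIT.
Qed.
End ComplexExpectation.

(** * Products of independent variables *)
Section Independence.
Context d (T : measurableType d) (R : realType) (P : probability T R).
Implicit Types (Y : T -> R) (Z W : T -> R[i]) (F : set (set T)).
Local Notation E := (complex_expectation P).

(** The uniform closure of the linear span of the indicators of events of [F]. It
    stands for measurability with respect to [F]: what is linear and continuous
    in the variable needs a proof for indicators only. *)
Definition simple_limit F Z : Prop := cbounded Z /\
  forall e : R, 0 < e -> exists (n : nat) (c : 'I_n -> R[i]) (A : 'I_n -> set T),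
    (forall k, F (A k)) /\
    forall w, `|Z w - \sum_(k < n) c k * cindic R (A k) w| <= e%:C%C.

Lemma simple_limit_indic F A : measurable A -> F A -> simple_limit F (cindic R A).
Proof.
move=> mA FA; split; first exact: cbounded_indic.
move=> e e0; exists 1%N, (fun=> 1), (fun=> A); split=> // w.
by rewrite big_ord1 mul1r subrr normr0 ler0c ltW.
Qed.

Lemma simple_limitZ F c Z : simple_limit F Z -> simple_limit F (fun w => c * Z w).
Proof.
move=> [bZ apZ]; split; first exact: cboundedZ.
move=> e e0; pose M : R := complex.Re `|c| + 1.
have cE : (complex.Re `|c|)%:C%C = `|c| by rewrite RRe_real ?normr_real.
have cM : `|c| <= M%:C%C by rewrite -cE lecR lerDl ler01.
have M0 : 0 < M by rewrite ltr_pwDr // -ler0c cE.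
have [n [a [A [FA ZA]]]] := apZ (e / M) (divr_gt0 e0 M0).
exists n, (fun k => c * a k), A; split=> // w.
under eq_bigr do rewrite -mulrA.
have eE : e%:C%C = M%:C%C * (e / M)%:C%C.
  by rewrite -rmorphM mulrC divfK // gt_eqF.
by rewrite -mulr_sumr -mulrBr normrM eE ler_pM.
Qed.

Lemma simple_limitD F Z W : simple_limit F Z -> simple_limit F W ->
  simple_limit F (fun w => Z w + W w).
Proof.
move=> [bZ apZ] [bW apW]; split; first exact: cboundedD.
move=> e e0; have e20 : 0 < e / 2 by rewrite divr_gt0.
have [n [a [A [FA ZA]]]] := apZ _ e20; have [p [b [B [FB WB]]]] := apW _ e20.
exists (n + p)%N, (fun k => match fintype.split k with inl i => a i | inr j => b j end),
  (fun k => match fintype.split k with inl i => A i | inr j => B j end); split.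
  by move=> k; case: (fintype.split k).
move=> w; rewrite big_split_ord /=.
under eq_bigr => i _ do rewrite (unsplitK (inl i)).
under [X in _ - (_ + X)]eq_bigr => i _ do rewrite (unsplitK (inr i)).
rewrite opprD addrACA [e]splitr rmorphD.
by apply: le_trans (ler_normD _ _) _; apply: lerD.
Qed.

Lemma sum_ltn_ord u n : (\sum_(k < n) (k < u))%N = minn u n.
Proof.
elim: n => [|n IH]; first by rewrite big_ord0 minn0.
by rewrite big_ord_recr IH /=; lia.
Qed.

(** Layer by layer approximation: for [0 <= Y <= 1], the number of [k < n] with
    [k.+1 / n <= Y] is the integer part of [n * Y]. *)
Lemma simple_limit_real01 F Y : measurable_fun [set: T] Y ->
  (forall a : R, F (Y @^-1` [set x | a <= x])) ->
  (forall w, 0 <= Y w <= 1) -> simple_limit F (fun w => (Y w)%:C%C).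
Proof.
move=> mY FY Y01; split.
  split; first by split; [exact: mY | exact: measurable_cst].
  exists 1 => w; have /andP[Y0 Y1] := Y01 w.
  by rewrite ger0_norm ?ler0c // lecR.
move=> e e0; have [n ne] : exists n : nat, e^-1 < n.+1%:R.
  by exists (Num.truncn e^-1); rewrite truncnS_gt.
have n0 : 0 < n.+1%:R :> R by rewrite ltr0n.
exists n.+1, (fun=> (n.+1%:R^-1)%:C%C),
  (fun k => Y @^-1` [set x | k.+1%:R / n.+1%:R <= x]); split=> // w.
have /andP[Y0 Y1] := Y01 w.
set u := Num.truncn (n.+1%:R * Y w).
have uP : u%:R <= n.+1%:R * Y w < u.+1%:R by apply: truncn_itv; rewrite mulr_ge0 // ltW.
have u_le : (u <= n.+1)%N.
  rewrite -(ler_nat R); case/andP: uP => /le_trans + _; apply.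
  by rewrite -[leRHS]mulr1 ler_pM2l.
have -> : \sum_(k < n.+1) (n.+1%:R^-1)%:C%C *
    cindic R (Y @^-1` [set x | k.+1%:R / n.+1%:R <= x]) w = (u%:R / n.+1%:R)%:C%C.
  rewrite -mulr_sumr mulrC rmorphM; congr (_ * _).
  have -> : u = (\sum_(k < n.+1) (k < u))%N by rewrite sum_ltn_ord (minn_idPl u_le).
  rewrite rmorph_nat natr_sum; apply: eq_bigr => k _; rewrite cindicE.
  have <- : (k.+1%:R / n.+1%:R <= Y w) = (k < u)%N.
    by rewrite truncn_gt_nat ler_pdivrMr // [_ * Y w]mulrC.
  by congr ((nat_of_bool _)%:R); apply/idP/idP; rewrite inE.
have -> : (Y w)%:C%C - (u%:R / n.+1%:R)%:C%C = (Y w - u%:R / n.+1%:R)%:C%C.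
  by rewrite rmorphB.
rewrite normc_def /= expr0n addr0 sqrtr_sqr lecR.
have Ne : n.+1%:R^-1 <= e by rewrite -[e]invrK lef_pV2 ?posrE ?invr_gt0 // ltW.
case/andP: uP => uY Yu; rewrite ger0_norm.
  apply: le_trans Ne; rewrite lerBlDl -[X in _ <= _ + X]mul1r -mulrDl.
  by rewrite ler_pdivlMr // mulrC natr1 ltW.
by rewrite subr_ge0 ler_pdivrMr // mulrC.
Qed.
Lemma simple_limit_real F Y : F [set: T] -> measurable_fun [set: T] Y ->
  (forall a : R, F (Y @^-1` [set x | a <= x])) ->
  (forall w, `|Y w| <= 1) -> simple_limit F (fun w => (Y w)%:C%C).
Proof.
move=> FT mY FY Y1; pose Y' w := (Y w + 1) / 2.
have -> : (fun w => (Y w)%:C%C) = (fun w => 2 * (Y' w)%:C%C + (-1) * cindic R [set: T] w).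
  apply/funext => w; rewrite cindicE in_setT mulr1 /Y'.
  have -> : 2 = 2%:C%C :> R[i] by rewrite rmorph_nat.
  have -> : -1 = (-1)%:C%C :> R[i] by rewrite rmorphN1.
  by rewrite -rmorphM -rmorphD; congr _%:C%C; field.
apply: simple_limitD; last by apply: simple_limitZ; exact: simple_limit_indic.
apply: simple_limitZ; apply: simple_limit_real01.
- have -> : Y' = (fun w => 2^-1 * (Y \+ cst 1) w) by apply/funext => w; rewrite mulrC.
  by apply: measurable_funM => //; apply: measurable_funD.
- move=> a; have -> : Y' @^-1` [set x | a <= x] = Y @^-1` [set x | 2 * a - 1 <= x].
    by apply/seteqP; split=> w /=; rewrite /Y'; lra.
  exact: FY.
- by move=> w; have := Y1 w; rewrite ler_norml /Y'; lra.
Qed.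

(** Both sides are continuous in [Z] for uniform convergence, so an identity
    that holds for indicators of events of [F] passes to their limits. *)
Lemma factor_limit F Z W c : (forall B, F B -> measurable B) ->
  cbounded W -> simple_limit F Z ->
  (forall B, F B -> E (fun w => W w * cindic R B w) = c * E (cindic R B)) ->
  E (fun w => W w * Z w) = c * E Z.
Proof.
move=> Fm bW [bZ apZ] FW.
have bWZ : cbounded (fun w => W w * Z w) by exact: cboundedM.
have [_ [M WM]] := bW.
pose C : R := M + complex.Re `|c|.
have small e : 0 < e -> `|E (fun w => W w * Z w) - c * E Z| <= (C * (e *+ 2))%:C%C.
  move=> e0; have [n [a [A [FA ZA]]]] := apZ e e0.
  pose S w := \sum_(k < n) a k * cindic R (A k) w.
  have bI k : cbounded (cindic R (A k)) by apply: cbounded_indic; exact: Fm.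
  have bS : cbounded S by apply: cbounded_sum => k _; exact: cboundedZ.
  have bWS : cbounded (fun w => W w * S w) by exact: cboundedM.
  have bD : cbounded (fun w => Z w - S w) by exact: cboundedB.
  have eS : E (fun w => W w * S w) = c * E S.
    rewrite /S cexpectation_sum => [|k _]; last exact: cboundedZ.
    rewrite mulr_sumr; under [LHS]eq_cexpectation do rewrite mulr_sumr.
    rewrite cexpectation_sum => [|k _]; last by apply: cboundedM => //; exact: cboundedZ.
    apply: eq_bigr => k _; rewrite cexpectationZ // mulrCA -FW //.
    rewrite -cexpectationZ; last exact: cboundedM.
    by apply: eq_cexpectation => w; rewrite mulrCA.
  have -> : E (fun w => W w * Z w) - c * E Z =
      E (fun w => W w * (Z w - S w)) - c * E (fun w => Z w - S w).
    rewrite [in RHS]cexpectationB // mulrBr -eS.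
    under [X in _ = X - _]eq_cexpectation do rewrite mulrBr.
    by rewrite cexpectationB // opprB addrA subrK.
  have cE : (complex.Re `|c|)%:C%C = `|c| by rewrite RRe_real ?normr_real.
  have -> : (C * (e *+ 2))%:C%C = ((M * e) *+ 2)%:C%C + `|c| * (e *+ 2)%:C%C.
    by rewrite -{1}cE -rmorphM -rmorphD -mulrnAr -mulrDl.
  apply: le_trans (ler_normB _ _) _; rewrite normrM; apply: lerD.
    apply: norm_cexpectation_le => [|w]; first exact: cboundedM.
    by rewrite normrM rmorphM ler_pM.
  by apply: ler_wpM2l => //; exact: norm_cexpectation_le.
apply/eqP; rewrite -subr_eq0 -normr_eq0; apply/eqP.
set z := (X in `|X|); have zE : (complex.Re `|z|)%:C%C = `|z|.
  by rewrite RRe_real ?normr_real.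
rewrite -zE; congr _%:C%C; apply/eqP; rewrite eq_le -ler0c zE normr_ge0 andbT.
apply/ler_addgt0Pl => e e0; rewrite addr0 -lecR zE.
have C0 : 0 < `|C| + 1 by rewrite ltr_pwDr.
have e'0 : 0 < e / (`|C| + 1) / 2 by rewrite !divr_gt0.
have e'E : e / (`|C| + 1) / 2 *+ 2 = e / (`|C| + 1) by rewrite [RHS]splitr.
apply: le_trans (small _ e'0) _; rewrite lecR e'E.
rewrite mulrA ler_pdivrMr // mulrC ler_pM2l //.
by apply: le_trans (ler_norm C) _; rewrite lerDl.
Qed.

(** Independence is the case where all factors are indicators. The factors are
    then replaced one at a time, the others being kept as a bounded weight. *)
Lemma cexpectation_prod (I : finType) (F : I -> set (set T)) (Z : I -> T -> R[i]) :
  (forall i B, F i B -> measurable B) -> (forall i, F i [set: T]) ->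
  independent P F -> (forall i, simple_limit (F i) (Z i)) ->
  E (fun w => \prod_i Z i w) = \prod_i E (Z i).
Proof.
move=> Fm FT ind sZ.
suff H (r : seq I) (A : I -> set T) : uniq r -> (forall i, F i (A i)) ->
    E (fun w => \prod_i (if i \in r then Z i w else cindic R (A i) w)) =
    \prod_i (if i \in r then E (Z i) else E (cindic R (A i))).
  have := H (enum I) (fun=> [set: T]) (enum_uniq I) FT.
  under [X in _ = X -> _]eq_bigr do rewrite mem_enum.
  by under [X in X = _ -> _]eq_cexpectation do under eq_bigr do rewrite mem_enum.
elim: r A => [|k r IH] A /=.
  move=> _ FA.
  have mA i : measurable (A i) by exact: Fm (FA i).
  pose B := \bigcap_(i in [set i | i \in [set: I]%SET]) A i.
  have mB : measurable B by apply: fin_bigcap_measurable => // ; exact: finite_finset.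
  have -> : (fun w => \prod_i (if i \in [::] then Z i w else cindic R (A i) w)) =
      cindic R B.
    apply/funext => w; under eq_bigr => i _ do rewrite /= cindicE.
    rewrite cindicE; case: (boolP (w \in B)) => [|wB].
      rewrite inE => wB; rewrite big1 // => i _; rewrite mem_set //.
      by apply: wB; rewrite /= inE.
    have [i wi] : exists i, w \notin A i.
      apply: contrapT => no; case/negP: wB; rewrite inE => i _.
      by apply: contrapT => wAi; apply: no; exists i; rewrite notin_setE.
    by rewrite (bigD1 i) //= (negbTE wi) mul0r.
  rewrite cexpectation_indic // (ind _ _ FA) rmorph_prod.
  by apply: eq_big => [i|i _]; [rewrite inE | rewrite /= cexpectation_indic].
case/andP=> kr ur FA.
have bI i : cbounded (cindic R (A i)) by apply: cbounded_indic; exact: Fm (FA i).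
pose W w := \prod_(i | i != k) (if i \in r then Z i w else cindic R (A i) w).
pose c := \prod_(i | i != k) (if i \in r then E (Z i) else E (cindic R (A i))).
have -> : (fun w => \prod_i (if i \in k :: r then Z i w else cindic R (A i) w)) =
    (fun w => W w * Z k w).
  apply/funext => w; rewrite (bigD1 k) //= mem_head mulrC; congr (_ * _).
  by apply: eq_bigr => i ik; rewrite in_cons (negbTE ik).
rewrite (bigD1 k) //= mem_head mulrC.
have -> : \prod_(i | i != k) (if i \in k :: r then E (Z i) else E (cindic R (A i))) = c.
  by apply: eq_bigr => i ik; rewrite in_cons (negbTE ik).
apply: (factor_limit (Fm k)) (sZ k) _.
  by apply: cbounded_prod => i _; case: (i \in r) => //; have [] := sZ i.
move=> B FB; pose A' i := if i == k then B else A i.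
have FA' i : F i (A' i) by rewrite /A'; case: eqP => [->|].
have := IH A' ur FA'; rewrite (bigD1 k) //= (negbTE kr) {2}/A' eqxx mulrC.
under [X in _ = X * _ -> _]eq_bigr => i ik do rewrite /A' (negbTE ik).
rewrite -/c => <-; apply: eq_cexpectation => w.
rewrite (bigD1 k) //= (negbTE kr) {1}/A' eqxx mulrC; congr (_ * _).
by apply: eq_bigr => i ik; rewrite /A' (negbTE ik).
Qed.
End Independence.

(** * Moments of the uniform law on the circle *)
Section Laws.
Context d (T : measurableType d) (R : realType) (P : probability T R).
Implicit Types (X : T -> R[i]).
Local Notation E := (complex_expectation P).

Definition cplx (p : R * R) : R[i] := (p.1 +i* p.2)%C.

Lemma re_imK : cancel (@re_im R) cplx. Proof. by case. Qed.

Lemma cmeasurable_cplx : cmeasurable cplx.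
Proof. by split; [exact: measurable_fst | exact: measurable_snd]. Qed.

Lemma sigma_complex_measurable X B : complex_rv X -> sigma_complex X B -> measurable B.
Proof. by move=> mX [B' mB' <-]; rewrite -[X in measurable X]setTI; exact: mX. Qed.

Lemma sigma_complexT X : sigma_complex X [set: T].
Proof. by exists setT => //; exact: measurableT. Qed.

Lemma simple_limit_complex X (g : R[i] -> R[i]) : complex_rv X ->
  cmeasurable (g \o cplx) -> (forall w, `|g (X w)| <= 1) ->
  simple_limit (sigma_complex X) (fun w => g (X w)).
Proof.
move=> mX [rg ig] g1.
have real_part (psi : R * R -> R) : measurable_fun [set: R * R] psi ->
    (forall w, `|psi (re_im (X w))| <= 1) ->
    simple_limit (sigma_complex X) (fun w => (psi (re_im (X w)))%:C%C).
  move=> mpsi psi1; apply: simple_limit_real => //; first exact: sigma_complexT.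
    exact: (measurableT_comp mpsi mX).
  move=> a; exists (psi @^-1` [set x | a <= x]) => //.
  rewrite /mkset -[X in measurable X]setTI; apply: mpsi => //.
  rewrite [X in measurable X](_ : _ = `[a, +oo[%classic) //.
  by apply/seteqP; split=> x /=; rewrite in_itv /= andbT.
have -> : (fun w => g (X w)) = (fun w =>
    ((@complex.Re R \o (g \o cplx)) (re_im (X w)))%:C%C +
    'i%C * ((@complex.Im R \o (g \o cplx)) (re_im (X w)))%:C%C).
  by apply/funext => w; rewrite /= re_imK -complexE.
have gb w : `|complex.Re (g (X w))| <= 1 /\ `|complex.Im (g (X w))| <= 1.
  exact: normc_le_ReIm.
apply: simple_limitD; last apply: simple_limitZ.
  by apply: real_part => // w; rewrite /= re_imK; have [] := gb w.
by apply: real_part => // w; rewrite /= re_imK; have [] := gb w.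
Qed.

(** Integer powers on the unit circle, where inversion is conjugation. *)
Definition upow (a : int) (z : R[i]) : R[i] :=
  if a is Negz n then (z^*%C) ^+ n.+1 else z ^+ `|a|%N.

Lemma upowE a z : `|z| = 1 -> z ^ a = upow a z.
Proof.
move=> z1; case: a => n //; rewrite -[LHS]/((z ^+ n.+1)^-1) -exprVn.
rewrite invc_norm z1 expr1n invr1. by rewrite mul1r.
Qed.

Lemma cmeasurable_upow a : cmeasurable (upow a \o cplx).
Proof.
case: a => n /=; apply: cmeasurableX; first exact: cmeasurable_cplx.
split; first exact: measurable_fst.
rewrite (_ : _ \o _ = \- (@snd R R)); last by apply/funext; case.
apply: measurable_funN; exact: measurable_snd.
Qed.

Lemma simple_limit_pow X a : complex_rv X -> (forall w, `|X w| = 1) ->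
  simple_limit (sigma_complex X) (fun w => X w ^ a).
Proof.
move=> mX X1; under eq_fun do rewrite upowE //.
apply: simple_limit_complex => //; first exact: cmeasurable_upow.
by move=> w; case: a => n; rewrite /= normrX ?normcJ X1 expr1n.
Qed.

Lemma expc_cos_sin (theta : R) n :
  (cos theta +i* sin theta)%C ^+ n = (cos (theta *+ n) +i* sin (theta *+ n))%C.
Proof.
elim: n => [|n IH]; first by rewrite expr0 mulr0n cos0 sin0.
rewrite exprS IH mulrS cosD sinD /=; simpc; congr Complex; ring.
Qed.

Lemma normc_cos_sin (theta : R) : `|(cos theta +i* sin theta)%C| = 1 :> R[i].
Proof. by rewrite normc_def /= cos2Dsin2 sqrtr1. Qed.

(** Adding [1] makes the integrand nonnegative, so that the law of [X] can be
    transported to the angle. *)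
Lemma circle_mean0 X (g : R[i] -> R) (F : R -> R) : uniform_circle P X ->
  measurable_fun [set: R * R] (g \o cplx) ->
  (forall z, `|z| = 1 -> `|g z| <= 1) ->
  continuous (fun theta => g (cos theta +i* sin theta)%C) ->
  (forall theta, is_derive theta (1 : R) F (g (cos theta +i* sin theta)%C)) ->
  F (2 * pi) = F 0 ->
  Rintegral P [set: T] (fun w => g (X w)) = 0.
Proof.
move=> [mX X1 law] mg g1 cg dF F0.
pose G theta := g (cos theta +i* sin theta)%C.
have G1 theta : 0 <= 1 + G theta.
  by have := g1 _ (normc_cos_sin theta); rewrite ler_norml -/(G theta) => /andP[]; lra.
have gX1 w : 0 <= 1 + g (X w).
  by have := g1 _ (X1 w); rewrite ler_norml => /andP[]; lra.
pose phi p := `|1 + g (cplx p)|.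
have mphi : measurable_fun [set: R * R] phi.
  by apply: measurableT_comp => //; apply: measurable_funD.
pose cs (theta : measurableTypeR R) : R * R := (cos theta, sin theta).
have mcs : measurable_fun [set: measurableTypeR R] cs.
  apply: measurable_fun_pair; apply: continuous_measurable_fun.
    exact: continuous_cos.
  exact: continuous_sin.
have mgX : measurable_fun [set: T] (fun w => g (X w)).
  rewrite (_ : (fun w => _) = (g \o cplx) \o (@re_im R \o X)).
    exact: measurableT_comp.
  by apply/funext => w; rewrite /= re_imK.
have igX : P.-integrable [set: T] (EFin \o (fun w => g (X w))).
  by apply: (@bounded_integrable _ _ _ _ _ 1) => // w; exact: g1.
have int1 : (\int[P]_w (1 + g (X w))%:E = 1)%E.
  transitivity (\int[pushforward P (@re_im R \o X)]_p (phi p)%:E)%E.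
    rewrite (ge0_integral_pushforward mX) //=.
    - by apply: eq_integral => w _; rewrite /phi /= re_imK ger0_norm.
    - exact/measurable_EFinP.
    - by move=> p _; rewrite lee_fin normr_ge0.
  transitivity (\int[pushforward (uniform_prob (two_pi_gt0 R))
      cs]_p (phi p)%:E)%E.
    by apply: eq_measure_integral => B mB _; exact: law.
  transitivity (\int[uniform_prob (two_pi_gt0 R)]_theta (phi (cs theta))%:E)%E.
    apply: (ge0_integral_pushforward mcs (uniform_prob (two_pi_gt0 R))) => //=.
    - exact/measurable_EFinP.
    - by move=> p _; rewrite lee_fin normr_ge0.
  have mphics : measurable_fun [set: measurableTypeR R] (phi \o cs).
    exact: measurableT_comp.
  rewrite integral_uniform //=; last 2 first.
  - by apply/measurable_EFinP; exact: mphics.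
  - by move=> theta; rewrite lee_fin normr_ge0.
  rewrite (eq_integral (fun theta : measurableTypeR R => (1 + G theta)%:E)); last first.
    by move=> theta _; rewrite /phi /cs /cplx /= ger0_norm // G1.
  have dF1 (theta : R) : is_derive theta (1 : R) (fun u : R => u + F u) (1 + G theta).
    by apply: is_deriveD.
  have cF1 : continuous (fun u : R => u + F u).
    by move=> u; apply: differentiable_continuous; apply/derivable1_diffP; exact: ex_derive.
  rewrite (@continuous_FTC2 _ _ (fun u : R => u + F u)) ?two_pi_gt0 //.
  - have e : 2 * pi + F (2 * pi) - (0 + F 0) = 2 * pi by rewrite F0; ring.
    rewrite -EFinB e.
    rewrite -EFinM subr0 mulVf //.
    by rewrite gt_eqF ?two_pi_gt0.
  - by apply: continuous_subspaceT => u; apply: cvgD; [exact: cvg_cst | exact: cg].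
  - split; first by move=> u _; exact: ex_derive.
      by apply: cvg_at_right_filter; exact: cF1.
    by apply: cvg_at_left_filter; exact: cF1.
  - by move=> u _; rewrite derive1E; exact: derive_val.
have : Rintegral P [set: T] (fun w => 1 + g (X w)) = 1 by rewrite /Rintegral int1.
rewrite RintegralD // ?Rintegral_prob_cst; first by lra.
by apply: (@bounded_integrable _ _ _ _ _ 1) => [|w]; [exact: measurable_cst | rewrite normr1].
Qed.

Lemma circle_moment_nat X n : uniform_circle P X -> (0 < n)%N ->
  E (fun w => X w ^+ n) = 0.
Proof.
move=> uX n0; have nR : n%:R != 0 :> R by rewrite pnatr_eq0 -lt0n.
have [mre mim] : cmeasurable (fun p => cplx p ^+ n).
  by apply: cmeasurableX; exact: cmeasurable_cplx.
have X1 z : `|z| = 1 -> `|z ^+ n| <= 1%:C%C :> R[i] by move=> z1; rewrite normrX z1 expr1n.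
have turn0 : cos ((2 * pi) *+ n) = 1 :> R /\ sin ((2 * pi) *+ n) = 0 :> R.
  have [] : cos (2 * pi) = 1 :> R /\ sin (2 * pi) = 0 :> R.
    by rewrite mulr_natl cos2pi sin2pi.
  move: (2 * pi) => x c1 s0; elim: (n) => [|k [IHc IHs]].
    by rewrite mulr0n cos0 sin0.
  by rewrite mulrS cosD sinD c1 s0 IHc IHs; split; ring.
have cn : continuous (fun u : R => u *+ n).
  by move=> u; apply: cvgMn; exact: cvg_id.
have dn (u : R) : is_derive u (1 : R) (fun v : R => v *+ n) n%:R.
  have -> : (fun v : R => v *+ n) = n%:R \*: id by apply/funext => v; rewrite /= scaler_nat.
  by apply: is_derive_eq; exact: mulr1.
rewrite cexpectationE; congr Complex.
  apply: (@circle_mean0 X (fun z => complex.Re (z ^+ n)) (fun u => sin (u *+ n) / n%:R)) => //.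
  - by move=> z /X1 /normc_le_ReIm[].
  - move=> u; under eq_fun do rewrite expc_cos_sin /=.
    by apply: continuous_comp; [exact: cn | exact: continuous_cos].
  - move=> u; rewrite expc_cos_sin /=.
    have -> : (fun v : R => sin (v *+ n) / n%:R) = n%:R^-1 \*: (sin \o (fun v => v *+ n)).
      by apply/funext => v; rewrite /= mulrC.
    apply: is_derive_eq; rewrite -[LHS]/(n%:R^-1 * (cos (u *+ n) * n%:R)).
    by rewrite mulrCA mulVf ?mulr1.
  - by case: turn0 => _ ->; rewrite mul0rn sin0.
apply: (@circle_mean0 X (fun z => complex.Im (z ^+ n)) (fun u => - cos (u *+ n) / n%:R)) => //.
- by move=> z /X1 /normc_le_ReIm[].
- move=> u; under eq_fun do rewrite expc_cos_sin /=.
  by apply: continuous_comp; [exact: cn | exact: continuous_sin].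
- move=> u; rewrite expc_cos_sin /=.
  have -> : (fun v : R => - cos (v *+ n) / n%:R) = (- n%:R^-1) \*: (cos \o (fun v => v *+ n)).
    by apply/funext => v; rewrite -[RHS]/(- n%:R^-1 * cos (v *+ n)) !mulNr mulrC.
  apply: is_derive_eq; rewrite -[LHS]/(- n%:R^-1 * (- sin (u *+ n) * n%:R)).
  by rewrite !mulNr mulrN opprK mulrCA mulVf ?mulr1.
- by case: turn0 => -> _; rewrite mul0rn cos0.
Qed.

Lemma expectation_conj Z : cbounded Z -> E (fun w => (Z w)^*%C) = (E Z)^*%C.
Proof.
move=> bZ; have [_ iZ] := cbounded_integrable P bZ.
rewrite !cexpectationE /=; congr Complex.
  by apply: eq_Rintegral => w _; case: (Z w).
rewrite -[RHS]mulN1r -RintegralZl //.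
by apply: eq_Rintegral => w _; case: (Z w) => a b /=; rewrite mulN1r.
Qed.

Lemma circle_moment X a : uniform_circle P X -> a != 0 -> E (fun w => X w ^ a) = 0.
Proof.
move=> uX a0; have [mX X1 _] := uX.
have bX n : cbounded (fun w => X w ^+ n).
  have [] := simple_limit_pow n mX X1; exact.
under eq_cexpectation do rewrite upowE //.
case: a a0 => n a0 /=; first by apply: circle_moment_nat => //; lia.
have -> : (fun w => (X w)^*%C ^+ n.+1) = (fun w => (X w ^+ n.+1)^*%C).
  by apply/funext => w; rewrite rmorphXn.
by rewrite expectation_conj // circle_moment_nat // conjc0.
Qed.

End Laws.

(** * Moments of uniform signs and roots of unity *)
Section DiscreteLaws.
Context d (T : measurableType d) (R : realType) (P : probability T R).
Implicit Types (X : T -> R[i]).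
Local Notation E := (complex_expectation P).

Lemma measurable_fiber X z : complex_rv X -> measurable (X @^-1` [set z]).
Proof.
move=> mX; have -> : X @^-1` [set z] = (@re_im R \o X) @^-1` [set re_im z].
  apply/seteqP; split=> w /= [e].
    by rewrite e.
  by case: (X w) z e => a b [a' b'] /= -> ->.
rewrite -[X in measurable X]setTI; apply: mX => //.
have -> : [set re_im z] = [set complex.Re z] `*` [set complex.Im z].
  apply/seteqP; split=> [_ -> //|[a b]] [/= -> ->]; by case: z.
exact: measurableX.
Qed.

Lemma expectation_fiber X z (p : R) : complex_rv X -> P (X @^-1` [set z]) = p%:E ->
  E (cindic R (X @^-1` [set z])) = p%:C%C.
Proof. by move=> mX Pz; rewrite cexpectation_indic ?Pz //; exact: measurable_fiber. Qed.

Lemma sign_moment X : uniform_sign P X -> E X = 0.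
Proof.
move=> [mX X1 P1 PN1].
have bI z : cbounded (cindic R (X @^-1` [set z])).
  by apply: cbounded_indic; exact: measurable_fiber.
have -> : X = (fun w => cindic R (X @^-1` [set 1]) w - cindic R (X @^-1` [set -1]) w).
  apply/funext => w; rewrite !cindicE.
  have n11 : (1 == -1 :> R[i]) = false by rewrite gt_eqF // (lt_trans (ltrN10 _)) ?ltr01.
  have mem z : (w \in X @^-1` [set z]) = (X w == z).
    by apply/idP/eqP; rewrite inE.
  by rewrite !mem; case: (X1 w) => ->; rewrite ?eqxx ?n11 1?eq_sym ?n11 ?subr0 ?sub0r.
by rewrite cexpectationB // !(@expectation_fiber _ _ 2^-1) // subrr.
Qed.

Lemma norm_root (k : nat) (z : R[i]) : (0 < k)%N -> z ^+ k = 1 -> `|z| = 1.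
Proof.
move=> k0 zk; apply/eqP; rewrite -(@pexpr_eq1 _ _ k) //.
by rewrite -normrX zk normr1.
Qed.

Lemma complex_prim_root (k : nat) : (0 < k)%N -> exists z : R[i], k.-primitive_root z.
Proof.
move=> k0; pose p : {poly R[i]} := 'X^k - 1.
have [r Dp] := closed_field_poly_normal p.
rewrite (monicP _) ?monicXnsubC // scale1r in Dp.
have rk1 : all k.-unity_root r by apply/allP => z; rewrite -root_prod_XsubC -Dp.
have sz_r : (k < (size r).+1)%N.
  by rewrite -(size_prod_XsubC r id) -Dp size_XnsubC.
have [|z] := hasP (has_prim_root k0 rk1 _ sz_r); last by exists z.
by rewrite -separable_prod_XsubC -Dp separable_Xn_sub_1 // pnatr_eq0 -lt0n.
Qed.

(** On the [k]-th roots of unity, the [n]-th power averages to a geometric sum of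
    ratio different from 1. *)
Lemma root_moment X (k n : nat) : uniform_root P k X -> (0 < n < k)%N ->
  E (fun w => X w ^+ n) = 0.
Proof.
move=> [mX Xk PX] /andP[n0 nk]; have k0 : (0 < k)%N by lia.
have [z pz] := complex_prim_root k0.
have bI u : cbounded (cindic R (X @^-1` [set u])).
  by apply: cbounded_indic; exact: measurable_fiber.
have -> : (fun w => X w ^+ n) =
    (fun w => \sum_(j < k) (z ^+ n) ^+ j * cindic R (X @^-1` [set z ^+ j]) w).
  apply/funext => w; have [j Xj] := prim_rootP pz (Xk w).
  rewrite (bigD1 j) //= cindicE mem_set // mulr1 big1 ?addr0 => [|i ij].
    by rewrite Xj -!exprM mulnC.
  rewrite cindicE memNset ?mulr0 //= Xj => /eqP.
  rewrite (eq_prim_root_expr pz) !modn_small // => /eqP /val_inj ji.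
  by rewrite ji eqxx in ij.
rewrite cexpectation_sum => [|j _]; last exact: cboundedZ.
transitivity (\sum_(j < k) (z ^+ n) ^+ j * (k%:R^-1)%:C%C).
  apply: eq_bigr => j _; rewrite cexpectationZ // (@expectation_fiber _ _ k%:R^-1) //.
  by apply: PX; rewrite exprAC (prim_expr_order pz) expr1n.
rewrite -mulr_suml; have := subrX1 (z ^+ n) k.
rewrite exprAC (prim_expr_order pz) expr1n subrr => /esym/eqP.
rewrite mulf_eq0 subr_eq0 -(prim_order_dvd pz) gtnNdvd //= => /eqP ->.
by rewrite mul0r.
Qed.

Lemma sigma_perm_measurable N (V : T -> 'S_N) B : uniform_perm P V ->
  sigma_perm V B -> measurable B.
Proof.
move=> uV [C _ <-]; have -> : V @^-1` C = \bigcup_(s in C) (V @^-1` [set s]).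
  by apply/seteqP; split=> [w Cw|w [s Cs /= Vs]]; [exists (V w) | rewrite /preimage /= Vs].
by apply: fin_bigcup_measurable => [|s _]; [exact: finite_finset | have [] := uV s].
Qed.
End DiscreteLaws.

(** * Mean of a product of characters *)
Section Characters.
Variables (R : realType) (m0 r2 t : nat) (q : 'I_t -> nat).
Hypothesis hq : forall j, (3 <= q j)%N.
Variables (N : nat) (M : matrix_model R m0 r2 q N).
Local Notation Lambda := (Lam m0 r2 q).
Local Notation E := (complex_expectation (Pr M)).
Implicit Types (w : Omega M) (i : 'I_N) (l : Lambda).

Definition chi w i l : R[i] := Dmat w l i i.

Lemma chiE w i l : chi w i l = (\prod_(j < m0) Dc j i w ^ (l.1.1 j)) *
  (\prod_(j < r2) Ds j i w ^+ (l.1.2 j)) * (\prod_(j < t) Dr j i w ^+ (l.2 j)).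
Proof. by rewrite /chi /Dmat !mxE eqxx mulr1n. Qed.

Lemma norm_Dc j i w : `|Dc j i w| = 1.
Proof. by have [_ ->] := Dc_uniform M j i. Qed.

Lemma sqr_Ds j i w : Ds j i w ^+ 2 = 1.
Proof. by have [_ h _ _] := Ds_uniform M j i; case: (h w) => ->; rewrite ?sqrrN expr1n. Qed.

Lemma root_Dr j i w : Dr j i w ^+ q j = 1.
Proof. by have [_ ->] := Dr_uniform M j i. Qed.

Lemma expr_Zp_add (z : R[i]) (k : nat) (a b : 'Z_k) : (1 < k)%N -> z ^+ k = 1 ->
  z ^+ (a + b)%R = z ^+ a * z ^+ b.
Proof.
by move=> k1 zk; rewrite -exprD /=; apply: expr_mod; rewrite Zp_cast.
Qed.

Lemma chi0 w i : chi w i 0 = 1.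
Proof.
rewrite chiE !big1 ?mulr1 // => j _; rewrite ffunE //.
Qed.

Lemma chiD w i l l' : chi w i (l + l') = chi w i l * chi w i l'.
Proof.
rewrite !chiE mulrACA [X in _ = X * _]mulrACA -!big_split /=.
congr (_ * _ * _); apply: eq_bigr => j _; rewrite ffunE.
- by rewrite expfzDr // -normr_eq0 norm_Dc oner_eq0.
- by rewrite expr_Zp_add // sqr_Ds.
- by rewrite expr_Zp_add ?root_Dr // (ltn_trans _ (hq j)).
Qed.

Definition char_prod w (F : {ffun 'I_N -> Lambda}) : R[i] := \prod_i chi w i (F i).

Lemma char_prodD w F F' : char_prod w (F + F') = char_prod w F * char_prod w F'.
Proof. by rewrite -big_split; apply: eq_bigr => i _; rewrite ffunE chiD. Qed.

Lemma char_prod0 w : char_prod w 0 = 1.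
Proof. by rewrite /char_prod big1 // => i _; rewrite ffunE chi0. Qed.

Definition perm_indic (s : 'S_N) w : R[i] := cindic R (V (m:=M) @^-1` [set s]) w.

Lemma perm_indicE s w : perm_indic s w = (V w == s)%:R.
Proof.
by rewrite /perm_indic cindicE; congr (_ %:R); congr nat_of_bool; apply/idP/eqP; rewrite inE.
Qed.

(** One factor for each independent variable, indexed as in the independence
    hypothesis of the model. *)
Definition entry_index : finType :=
  (unit + 'I_m0 * 'I_N + 'I_r2 * 'I_N + 'I_t * 'I_N)%type.

Definition entry_power s (F : {ffun 'I_N -> Lambda}) (k : entry_index) w : R[i] :=
  match k with
  | inl (inl (inl _)) => perm_indic s w
  | inl (inl (inr (j, i))) => Dc j i w ^ ((F i).1.1 j)
  | inl (inr (j, i)) => Ds j i w ^+ ((F i).1.2 j)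
  | inr (j, i) => Dr j i w ^+ ((F i).2 j)
  end.

Lemma entry_power_prod s F w :
  \prod_k entry_power s F k w = perm_indic s w * char_prod w F.
Proof.
rewrite !big_sumType /= -!mulrA; congr (_ * _).
  by rewrite (big_pred1 tt) // => -[].
rewrite /char_prod; under [RHS]eq_bigr do rewrite chiE.
rewrite !big_split /= -mulrA; congr (_ * (_ * _)); rewrite exchange_big /= pair_big /=;
  by apply: eq_bigr => -[].
Qed.

Lemma entry_power_limit s F k :
  simple_limit (match k with
       | inl (inl (inl _)) => sigma_perm (V (m:=M))
       | inl (inl (inr (j, i))) => sigma_complex (Dc (m:=M) j i)
       | inl (inr (j, i)) => sigma_complex (Ds (m:=M) j i)
       | inr (j, i) => sigma_complex (Dr (m:=M) j i)
       end) (entry_power s F k).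
Proof.
case: k => [[[[]|[j i]]|[j i]]|[j i]] /=.
- apply: simple_limit_indic; last by exists [set s].
  by have [] := V_uniform M s.
- have [rv _ _] := Dc_uniform M j i.
  by apply: simple_limit_pow => // w; exact: norm_Dc.
- have [rv _ _ _] := Ds_uniform M j i.
  by apply: (simple_limit_pow (Posz _)) => // w; exact: norm_root (sqr_Ds j i w).
- have [rv _ _] := Dr_uniform M j i.
  apply: (simple_limit_pow (Posz _)) => // w; apply: norm_root (root_Dr j i w).
  exact: ltn_trans (hq j).
Qed.

Lemma entry_power_mean s F :
  E (fun w => perm_indic s w * char_prod w F) = \prod_k E (entry_power s F k).
Proof.
under eq_cexpectation do rewrite -entry_power_prod.
apply: (cexpectation_prod _ _ (@all_independent _ _ _ _ _ _ M)).
- case=> [[[[]|[j i]]|[j i]]|[j i]] B.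
  + exact: sigma_perm_measurable (V_uniform M).
  + by have [rv _ _] := Dc_uniform M j i; exact: sigma_complex_measurable.
  + by have [rv _ _ _] := Ds_uniform M j i; exact: sigma_complex_measurable.
  + by have [rv _ _] := Dr_uniform M j i; exact: sigma_complex_measurable.
- case=> [[[[]|[j i]]|[j i]]|[j i]]; try exact: sigma_complexT.
  by exists setT.
- by move=> k; exact: entry_power_limit.
Qed.

(** If some [F i] is nonzero, one of its coordinates is, and the corresponding
    factor has mean zero. *)
Lemma mean_char_prod s F :
  E (fun w => perm_indic s w * char_prod w F) = (F == 0)%:R / N`!%:R.
Proof.
case: eqP => [->|F0].
  under eq_cexpectation do rewrite char_prod0 mulr1.
  have [mV PV] := V_uniform M s.
  by rewrite cexpectation_indic // PV /= mul1r fmorphV rmorph_nat.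
rewrite mul0r entry_power_mean.
suff [k Zk] : exists k, E (entry_power s F k) = 0 by rewrite (bigD1 k) //= Zk mul0r.
have [i Fi] : exists i, F i != 0.
  apply: contrapT => no; apply: F0; apply/ffunP => i; rewrite ffunE; apply: contrapT => Fi.
  by apply: no; exists i; apply/eqP.
have ne (X : Type) (Y : X -> zmodType) (u : forall x, Y x) : ~ (forall x, u x = 0) ->
    exists x, u x != 0.
  move=> nu; apply: contrapT => no; apply: nu => x; apply: contrapT => ux.
  by apply: no; exists x; apply/eqP.
case: (boolP ((F i).1.1 == 0)) => [/eqP F1|F1]; last first.
  have [j Fj] : exists j, (F i).1.1 j != 0.
    by apply: (ne _ (fun=> int)) => h; case/eqP: F1; apply/ffunP => j; rewrite h ffunE.
  by exists (inl (inl (inr (j, i)))); exact: circle_moment (Dc_uniform M j i) Fj.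
case: (boolP ((F i).1.2 == 0)) => [/eqP F2|F2]; last first.
  have [j Fj] : exists j, (F i).1.2 j != 0.
    by apply: (ne _ (fun=> 'Z_2)) => h; case/eqP: F2; apply/ffunP => j; rewrite h ffunE.
  have one : (F i).1.2 j = 1%N :> nat.
    by move: Fj; case: ((F i).1.2 j) => -[|[|//]].
  exists (inl (inr (j, i))); rewrite -[RHS](sign_moment (Ds_uniform M j i)).
  by apply: eq_cexpectation => w; rewrite /= one expr1.
have [j Fj] : exists j, (F i).2 j != 0.
  apply: (ne _ (fun j => 'Z_(q j))) => h; case/eqP: Fi.
  move: F1 F2 h; case: (F i) => -[a b] c /= -> -> h; congr (_, _).
  by apply/ffunP => j; rewrite h ffunE.
exists (inr (j, i)) => /=; apply: root_moment (Dr_uniform M j i) _.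
rewrite lt0n Fj /=; have := ltn_ord ((F i).2 j); rewrite {2}Zp_cast //.
exact: ltn_trans (hq j).
Qed.

End Characters.

(** * Traces of monomials as sums over fixed points *)
Lemma big_min_le (r : seq int) : \big[Num.min/0]_(k <- r) k <= 0 /\
  forall k, k \in r -> \big[Num.min/0]_(k <- r) k <= k.
Proof.
elim: r => [|a r [IH0 IH]]; first by rewrite big_nil.
rewrite big_cons; split=> [|k]; first by rewrite ge_min IH0 orbT.
by rewrite in_cons ge_min => /orP[/eqP ->|/IH ->]; rewrite ?lexx ?orbT.
Qed.

Lemma big_max_ge (r : seq int) : 0 <= \big[Num.max/0]_(k <- r) k /\
  forall k, k \in r -> k <= \big[Num.max/0]_(k <- r) k.
Proof.
elim: r => [|a r [IH0 IH]]; first by rewrite big_nil.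
rewrite big_cons; split=> [|k]; first by rewrite le_max IH0 orbT.
by rewrite in_cons le_max => /orP[/eqP ->|/IH ->]; rewrite ?lexx ?orbT.
Qed.

Section Traces.
Variables (R : realType) (m0 r2 t : nat) (q : 'I_t -> nat).
Hypothesis hq : forall j, (3 <= q j)%N.
Variables (N : nat) (M : matrix_model R m0 r2 q N).
Local Notation Lambda := (Lam m0 r2 q).
Local Notation E := (complex_expectation (Pr M)).
Implicit Types (w : Omega M) (f h : malg int Lambda) (g k : int).

Lemma line_bounds f g k : k \in [:: 0, g & msupp f : seq int] ->
  line_lo f g <= k <= line_lo f g + (line_len f g)%:Z.
Proof.
have [lo0 lo] := big_min_le (g :: msupp f).
have [hi0 hi] := big_max_ge (g :: msupp f).
rewrite -!/(line_lo f g) -!/(line_hi f g) in lo0 lo hi0 hi.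
have -> : line_lo f g + (line_len f g)%:Z = line_hi f g.
  by rewrite /line_len gez0_abs; lia.
by rewrite in_cons => /orP[/eqP ->|kr]; [rewrite lo0 hi0 | rewrite lo ?hi].
Qed.

Lemma vertexE f g k : k \in [:: 0, g & msupp f : seq int] ->
  line_lo f g + (vertex f g k)%:Z = k.
Proof.
move=> /line_bounds /andP[lo hi]; rewrite /vertex inordK; last by lia.
by rewrite gez0_abs; lia.
Qed.

Lemma big_line (f : malg int Lambda) g (G : int -> R[i]) :
  (forall k, k \notin msupp f -> G k = 1) ->
  \prod_(p < (line_len f g).+1) G (line_lo f g + p%:Z) = \prod_(k <- msupp f) G k.
Proof.
move=> G1; pose r := [seq line_lo f g + (p : nat)%:Z | p <- iota 0 (line_len f g).+1].
have -> : \prod_(p < (line_len f g).+1) G (line_lo f g + p%:Z) = \prod_(k <- r) G k.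
  by rewrite big_map -(big_mkord predT (fun p => G (line_lo f g + p%:Z))) /index_iota subn0.
rewrite (bigID (mem (msupp f))) /= [X in _ * X]big1 ?mulr1 => [|k /G1 //].
rewrite -big_filter; apply: perm_big; apply: uniq_perm.
- by rewrite filter_uniq // map_inj_uniq ?iota_uniq // => a b; lia.
- exact: fset_uniq.
move=> k; rewrite mem_filter; case: (boolP (k \in msupp f)) => //= kf.
have kr : k \in [:: 0, g & msupp f : seq int] by rewrite !in_cons kf !orbT.
apply/mapP; exists (vertex f g k : nat); last by rewrite vertexE.
by rewrite mem_iota /= add0n.
Qed.

Lemma char_prod_spike w a y : char_prod w (spike a y) = chi w y a.
Proof.
rewrite /char_prod (bigD1 y) //= ffunE eqxx mulr1n big1 ?mulr1 // => i iy.
by rewrite ffunE eq_sym (negbTE iy) mulr0n chi0.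
Qed.

Lemma char_prod_push w s f j : char_prod w (push s f j) =
  \prod_(k <- msupp f) chi w (zexpg s k j) (mcoeff k f).
Proof.
rewrite /push (big_morph _ (char_prodD hq w) (char_prod0 w)).
by apply: eq_bigr => k _; rewrite char_prod_spike.
Qed.

(** The entries of the permutation matrix force a labelling of the line to follow
    an orbit, so that it is determined by its value at the vertex 0; equality of
    input and output makes this value a fixed point of the power [g]. *)
Lemma tr_eval_monomial w f g : \tr (eval_monomial w f g) =
  \sum_(j | zexpg (V w)^-1%g g j == j) char_prod w (push (V w)^-1%g f j).
Proof.
set s := (V w)^-1%g; set L := line_len f g.
pose v k := vertex f g k.
pose steps (phi : {ffun 'I_L.+1 -> 'I_N}) :=
  [forall p : 'I_L, V w (phi (lift ord0 p)) == phi (widen_ord (leqnSn _) p)].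
pose walk j := [ffun p : 'I_L.+1 => zexpg s (line_lo f g + p%:Z) j].
pose B (phi : {ffun 'I_L.+1 -> 'I_N}) :=
  \prod_(p < L.+1) chi w (phi p) (mcoeff (line_lo f g + p%:Z) f).
have v0 : line_lo f g + (v 0)%:Z = 0 by apply: vertexE; rewrite mem_head.
have vg : line_lo f g + (v g)%:Z = g by apply: vertexE; rewrite !inE eqxx orbT.
have walkV j p : V w (zexpg s (p + 1) j) = zexpg s p j.
  by rewrite zexpg_permD zexpg1 /s permKV.
have walk_steps j : steps (walk j).
  apply/forallP => p; rewrite !ffunE; apply/eqP; rewrite -[RHS]walkV; congr (V w (zexpg s _ j)).
  by rewrite /= /bump /=; lia.
have steps_walk phi : steps phi -> walk (phi (v 0)) = phi.
  move=> /forallP st.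
  have from0 p (hp : (p < L.+1)%N) : phi (Ordinal hp) = zexpg s p (phi ord0).
    elim: p hp => [|p IH] hp.
      by rewrite zexpg0 perm1; congr (phi _); exact: val_inj.
    have /eqP := st (Ordinal (hp : (p < L)%N)).
    have -> : lift ord0 (Ordinal (hp : (p < L)%N)) = Ordinal hp by exact: val_inj.
    have -> : widen_ord (leqnSn L) (Ordinal (hp : (p < L)%N)) = Ordinal (ltnW hp).
      exact: val_inj.
    rewrite IH -(walkV (phi ord0) p%:Z) => /perm_inj ->.
    by congr (zexpg s _ _); lia.
  apply/ffunP => p; rewrite ffunE.
  case: (v 0) v0 => p0 hp0 /= v0; case: p => p hp.
  rewrite (from0 _ hp0) [RHS](from0 _ hp) -zexpg_permD.
  by congr (zexpg s _ _); rewrite /=; lia.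
have termE (phi : {ffun 'I_L.+1 -> 'I_N}) : (\prod_(p < L)
      Vmat w (phi (lift ord0 p)) (phi (widen_ord (leqnSn _) p))) *
    (\prod_(p < L.+1) Dmat w (mcoeff (line_lo f g + p%:Z) f) (phi p) (phi p)) =
    if steps phi then B phi else 0.
  case: ifPn => [/forallP st|]; last first.
    rewrite negb_forall => /existsP[p np]; rewrite (bigD1 p) //=.
    by rewrite /Vmat !mxE (negbTE np) !mul0r.
  by rewrite big1 ?mul1r // => p _; rewrite /Vmat !mxE (st p).
rewrite /mxtrace; under eq_bigr do rewrite mxE.
rewrite (exchange_big_dep
  (fun phi : {ffun 'I_L.+1 -> 'I_N} => phi (v g) == phi (v 0))) /=; last first.
  by move=> i phi _ /andP[/eqP -> /eqP ->].
transitivity (\sum_(phi : {ffun 'I_L.+1 -> 'I_N} |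
    (phi (v g) == phi (v 0)) && steps phi) B phi).
  rewrite big_mkcondr; apply: eq_bigr => phi /eqP e.
  rewrite (big_pred1 (phi (v 0))) => [|i]; last by rewrite /= e eq_sym andbb.
  exact: termE.
rewrite (reindex_onto walk (fun phi : {ffun 'I_L.+1 -> 'I_N} => phi (v 0))) /=; last first.
  by move=> phi /andP[_]; exact: steps_walk.
apply: eq_big => [j|j _].
  by rewrite walk_steps andbT !ffunE v0 vg zexpg0 perm1 eqxx andbT.
rewrite char_prod_push -(@big_line f g (fun k => chi w (zexpg s k j) (mcoeff k f))).
  by apply: eq_bigr => p _; rewrite ffunE.
by move=> k /mcoeff_outdom ->; rewrite chi0.
Qed.

Section MeanCount.
Variables (I : finType) (Q : 'S_N -> pred I) (F : 'S_N -> I -> {ffun 'I_N -> Lambda}).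

(** Splitting along the values of the permutation makes the points of summation
    deterministic. *)
Lemma char_sumE w : \sum_(p | Q (V w)^-1%g p) char_prod w (F (V w)^-1%g p) =
  \sum_(s : 'S_N) \sum_(p | Q s p) perm_indic s^-1%g w * char_prod w (F s p).
Proof.
rewrite [RHS](bigD1 (V w)^-1%g) //= [X in _ = _ + X]big1 ?addr0 => [|s sV].
  by apply: eq_bigr => p _; rewrite perm_indicE invgK eqxx mul1r.
rewrite big1 // => p _; rewrite perm_indicE eq_sym -(inj_eq invg_inj) invgK.
by rewrite (negbTE sV) mul0r.
Qed.

Lemma cbounded_char_term s (G : {ffun 'I_N -> Lambda}) :
  cbounded (fun w => perm_indic s w * char_prod w G).
Proof.
under eq_fun do rewrite -entry_power_prod; apply: cbounded_prod => k _.
by have [] := entry_power_limit hq M s G k.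
Qed.

Lemma cbounded_char_sum :
  cbounded (fun w => \sum_(p | Q (V w)^-1%g p) char_prod w (F (V w)^-1%g p)).
Proof.
under eq_fun do rewrite char_sumE; apply: cbounded_sum => s _.
by apply: cbounded_sum => p _; exact: cbounded_char_term.
Qed.

Lemma mean_char_sum :
  E (fun w => \sum_(p | Q (V w)^-1%g p) char_prod w (F (V w)^-1%g p)) =
  (\sum_(s : 'S_N) #|[pred p | Q s p && (F s p == 0%R)]|)%:R / N`!%:R.
Proof.
under eq_cexpectation do rewrite char_sumE.
rewrite cexpectation_sum => [|s _]; last first.
  by apply: cbounded_sum => p _; exact: cbounded_char_term.
rewrite natr_sum mulr_suml; apply: eq_bigr => s _.
rewrite cexpectation_sum => [|p _]; last exact: cbounded_char_term.
under eq_bigr do rewrite (mean_char_prod hq).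
rewrite -mulr_suml -natr_sum; congr (_%:R / _).
rewrite -sum1_card [RHS]big_mkcond [LHS]big_mkcond; apply: eq_bigr => p _.
by rewrite inE; case: (Q s p); case: eqP.
Qed.
End MeanCount.

Lemma cbounded_tr_monomial f g : cbounded (fun w => \tr (eval_monomial w f g)).
Proof.
under eq_fun do rewrite tr_eval_monomial.
exact: (@cbounded_char_sum _ (fun s j => zexpg s g j == j) (fun s j => push s f j)).
Qed.

Lemma mean_tr_monomial f g : E (fun w => \tr (eval_monomial w f g)) =
  (\sum_(s : 'S_N) #|fixed_set s f g|)%:R / N`!%:R.
Proof.
under eq_cexpectation do rewrite tr_eval_monomial.
rewrite (@mean_char_sum _ (fun s j => zexpg s g j == j) (fun s j => push s f j)).
by congr (_%:R / _); apply: eq_bigr => s _; apply: eq_card => j; rewrite !inE.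
Qed.

Lemma mean_tr_monomial2 f g h g' :
  E (fun w => \tr (eval_monomial w f g) * \tr (eval_monomial w h g')) =
  (\sum_(s : 'S_N) #|matched_pairs s f g h g'|)%:R / N`!%:R.
Proof.
transitivity (E (fun w => \sum_(p : 'I_N * 'I_N |
    (zexpg (V w)^-1%g g p.1 == p.1) && (zexpg (V w)^-1%g g' p.2 == p.2))
      char_prod w (push (V w)^-1%g f p.1 + push (V w)^-1%g h p.2))).
  apply: eq_cexpectation => w; rewrite !tr_eval_monomial big_distrlr /= pair_big /=.
  by apply: eq_bigr => p _; rewrite char_prodD.
rewrite (@mean_char_sum _ (fun s p => (zexpg s g p.1 == p.1) && (zexpg s g' p.2 == p.2))
  (fun s p => push s f p.1 + push s h p.2)).
congr (_%:R / _); apply: eq_bigr => s _; apply: eq_card => p; rewrite !inE.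
by rewrite andbA.
Qed.
End Traces.

(** * Linear functionals on the group algebra *)
Section LinearExtension.
Variables (R : realType) (G : groupType).
Implicit Types (h : G -> R[i]) (x y : galg R G) (k : G -> G -> R[i]).

Definition lext h x : R[i] := \sum_(u <- msupp x) mcoeff u x * h u.

Lemma lextEw h x (d : {fset G}) : (msupp x `<=` d)%fset ->
  lext h x = \sum_(u <- d) mcoeff u x * h u.
Proof.
move=> le; rewrite /lext (big_fset_incl _ le) //= => u _ ux.
by rewrite mcoeff_outdom // mul0r.
Qed.

Lemma lextD h : {morph lext h : x y / x + y}.
Proof.
move=> x y; rewrite !(@lextEw _ _ (msupp x `|` msupp y)%fset) ?fsubsetUl ?fsubsetUr //.
  by rewrite -big_split; apply: eq_bigr => u _; rewrite mcoeffD mulrDl.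
exact: msuppD_le.
Qed.

Lemma lext0 h : lext h 0 = 0.
Proof. by rewrite /lext msupp0 big_seq_fset0. Qed.

Lemma lextZ h c x : lext h (c *: x) = c * lext h x.
Proof.
rewrite (lextEw _ (@msuppZ_le _ _ c x)) /lext mulr_sumr.
by apply: eq_bigr => u _; rewrite mcoeffZ mulrA.
Qed.

Lemma lext_sum h (I : Type) (r : seq I) (Q : pred I) (F : I -> galg R G) :
  lext h (\sum_(i <- r | Q i) F i) = \sum_(i <- r | Q i) lext h (F i).
Proof. exact: (big_morph _ (lextD h) (lext0 h)). Qed.

Lemma lextU h u : lext h (U R u) = h u.
Proof. by rewrite (lextEw _ msuppU_le) big_seq_fset1 mcoeffUU mul1r. Qed.

Lemma eq_lext h h' x : {in msupp x, h =1 h'} -> lext h x = lext h' x.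
Proof. by move=> e; rewrite /lext !big_seq; apply: eq_bigr => u /e ->. Qed.

Lemma lext_delta v x : lext (fun u => (u == v)%:R) x = mcoeff v x.
Proof.
rewrite [in RHS](monalgE x) raddf_sum /lext; apply: eq_bigr => u _ /=.
by rewrite mcoeffU mulr_natr.
Qed.

Lemma galg_mulU x v : galg_mul x (U R v) = \sum_(u <- msupp x) mcoeff u x *: U R (u * v)%g.
Proof.
rewrite /galg_mul; apply: eq_bigr => u _.
rewrite (big_fset_incl _ (@msuppU_le _ _ v 1)) => [|v' _ /mcoeff_outdom ->].
  by rewrite big_seq_fset1 mcoeffUU mulr1.
by rewrite mulr0 scale0r.
Qed.

Definition bext k x y : R[i] := lext (fun u => lext (k u) y) x.

Lemma mcoeff1_galg_mul x y : mcoeff 1%g (galg_mul x y) =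
  bext (fun u v => ((u * v)%g == 1%g)%:R) x y.
Proof.
rewrite -lext_delta /galg_mul lext_sum; apply: eq_bigr => u _.
rewrite lext_sum mulr_sumr; apply: eq_bigr => v _.
by rewrite lextZ lextU mulrA.
Qed.
End LinearExtension.

(** * Limits of normalized traces *)
Section Limits.
Variable R : realType.

Lemma cvg_rate (a : nat -> R[i]) (l : R[i]) (C N0 : nat) :
  (forall N, (N0 <= N)%N -> `|l - a N| <= C%:R / N%:R) ->
  (a : nat -> R[i]^o) @ \oo --> (l : R[i]^o).
Proof.
move=> H; apply/cvgrPdist_le => e e0.
have eE : (complex.Re e)%:C%C = e by rewrite RRe_real // gtr0_real.
have r0 : 0 < complex.Re e by rewrite -ltcR eE.
near=> N.
have N0N : (N0 <= N)%N by near: N; exact: nbhs_infty_ge.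
apply: le_trans (H N N0N) _.
have CN : (Num.truncn (C%:R / complex.Re e) < N)%N by near: N; exact: nbhs_infty_gt.
have Npos : 0 < N%:R :> R by rewrite ltr0n; exact: leq_ltn_trans CN.
rewrite -eE -[C%:R](rmorph_nat (real_complex R)) -[N%:R](rmorph_nat (real_complex R)).
rewrite -fmorphV -rmorphM lecR ler_pdivrMr // mulrC -ler_pdivrMr //.
apply: ltW; apply: lt_le_trans (truncnS_gt _) _.
by rewrite ler_nat.
Unshelve. all: by end_near.
Qed.

Lemma cvg_sum_seq (I : Type) (r : seq I) (a : I -> nat -> R[i]^o) (l : I -> R[i]^o) :
  (forall i, a i @ \oo --> l i) ->
  (fun N => \sum_(i <- r) a i N : R[i]^o) @ \oo --> (\sum_(i <- r) l i : R[i]^o).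
Proof.
move=> al; elim: r => [|i r IH].
  by under eq_fun do rewrite big_nil; rewrite big_nil; exact: cvg_cst.
by under eq_fun do rewrite big_cons; rewrite big_cons; exact: cvgD (al i) IH.
Qed.

Lemma cvg_lext (G : groupType) (h : nat -> G -> R[i]) (l : G -> R[i]) (x : galg R G) :
  {in msupp x, forall u, (fun N => h N u : R[i]^o) @ \oo --> (l u : R[i]^o)} ->
  (fun N => lext (h N) x : R[i]^o) @ \oo --> (lext l x : R[i]^o).
Proof.
move=> hl.
pose a u N : R[i]^o := if u \in msupp x then mcoeff u x * h N u else 0.
pose b u : R[i]^o := if u \in msupp x then mcoeff u x * l u else 0.
have -> : lext l x = \sum_(u <- msupp x) b u.
  by rewrite /lext !big_seq; apply: eq_bigr => u; rewrite /b => ->.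
have -> : (fun N => lext (h N) x : R[i]^o) = (fun N => \sum_(u <- msupp x) a u N).
  by apply/funext => N; rewrite /lext !big_seq; apply: eq_bigr => u; rewrite /a => ->.
apply: cvg_sum_seq => u; rewrite /a /b; case: ifPn => [/hl hlu|_]; last exact: cvg_cst.
by apply: cvgMr; exact: hlu.
Qed.

Lemma ratio_close (S c F B : nat) : (0 < F)%N -> (S <= c * F + B * F)%N ->
  (c * F <= S + B * F)%N -> `|S%:R / F%:R - c%:R| <= B%:R :> R[i].
Proof.
move=> F0 up lo; have FR : 0 < F%:R :> R[i] by rewrite ltr0n.
have real : S%:R / F%:R - c%:R \is @Num.real R[i].
  by rewrite rpredB ?rpredM ?rpredV ?realn.
rewrite (real_ler_norml _ real) lerBlDr lerBrDr ler_pdivrMr // ler_pdivlMr //.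
rewrite -natrD -natrM ler_nat addnC mulnDl up andbT.
by rewrite addrC mulrBl -!natrM lerBlDr -natrD ler_nat.
Qed.
End Limits.

(** * The two functionals on monomials *)
Section Kernels.
Variables (R : realType) (m0 r2 t : nat) (q : 'I_t -> nat).
Hypothesis hq : forall j, (3 <= q j)%N.
Variable M : forall N : nat, matrix_model R m0 r2 q N.
Local Notation Lambda := (Lam m0 r2 q).
Local Notation G := (lamp m0 r2 q).
Local Notation CG := (galg R G).
Implicit Types (f h : malg int Lambda) (g k : int) (u v : G) (x y : CG).

Lemma supp_within_diam f : supp_within (Defs.diam f) f.
Proof.
by move=> k kf; rewrite /Defs.diam; case: ex_minnP => p /allP/(_ k kf).
Qed.

Definition mono_trace N u (w : Omega (M N)) : R[i] := \tr (eval_monomial w u.1 u.2).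

Definition mono_mean N u : R[i] := complex_expectation (Pr (M N)) (mono_trace u).

Definition mono_mean2 N u v : R[i] := complex_expectation (Pr (M N))
  (fun w => mono_trace u w * mono_trace v w).

Lemma tr_galg_eval N (w : Omega (M N)) x :
  \tr (galg_eval w x) = lext (fun u => mono_trace u w) x.
Proof. by rewrite /galg_eval raddf_sum; apply: eq_bigr => u _; rewrite /= mxtraceZ. Qed.

Lemma cbounded_mono N u : cbounded (mono_trace (N := N) u).
Proof. exact: (cbounded_tr_monomial hq). Qed.

Lemma cbounded_lext N x : cbounded (fun w : Omega (M N) => lext (fun u => mono_trace u w) x).
Proof. by apply: cbounded_sum => u _; apply: cboundedZ; exact: cbounded_mono. Qed.

Lemma mean_traceE N x : mean_trace M N x = lext (mono_mean N) x.
Proof.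
rewrite /mean_trace; under eq_cexpectation do rewrite tr_galg_eval.
rewrite cexpectation_sum => [|u _]; last by apply: cboundedZ; exact: cbounded_mono.
by apply: eq_bigr => u _; rewrite cexpectationZ //; exact: cbounded_mono.
Qed.

Lemma covarianceE N x y :
  complex_expectation (Pr (M N)) (fun w =>
    (\tr (galg_eval w x) - mean_trace M N x) * (\tr (galg_eval w y) - mean_trace M N y)) =
  bext (fun u v => mono_mean2 N u v - mono_mean N u * mono_mean N v) x y.
Proof.
under eq_cexpectation do rewrite !tr_galg_eval.
rewrite !mean_traceE; set a := lext _ x; set b := lext _ y.
pose A (w : Omega (M N)) := lext (fun u => mono_trace u w) x.
pose B (w : Omega (M N)) := lext (fun u => mono_trace u w) y.
have bA : cbounded A by exact: cbounded_lext.
have bB : cbounded B by exact: cbounded_lext.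
have EA : complex_expectation (Pr (M N)) A = a.
  by rewrite /a -mean_traceE; apply: eq_cexpectation => w; rewrite tr_galg_eval.
have EB : complex_expectation (Pr (M N)) B = b.
  by rewrite /b -mean_traceE; apply: eq_cexpectation => w; rewrite tr_galg_eval.
transitivity (complex_expectation (Pr (M N)) (fun w => A w * B w) - a * b).
  have -> : (fun w => (A w - a) * (B w - b)) =
      (fun w => A w * B w - (b * A w + (a * B w - a * b))).
    by apply/funext => w; ring.
  have bc : cbounded (fun _ : Omega (M N) => a * b) by exact: cbounded_cst.
  have baB := cboundedZ a bB; have bbA := cboundedZ b bA.
  rewrite cexpectationB; [|exact: cboundedM|by apply: cboundedD => //; exact: cboundedB].
  rewrite cexpectationD ?cexpectationB ?cexpectation_cst ?cexpectationZ //; last exact: cboundedB.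
  by rewrite EA EB; ring.
have -> : complex_expectation (Pr (M N)) (fun w => A w * B w) = bext (mono_mean2 N) x y.
  under eq_cexpectation do rewrite /A /B /lext big_distrlr /=.
  have bT u v : cbounded (fun w : Omega (M N) =>
      mcoeff u x * mono_trace u w * (mcoeff v y * mono_trace v w)).
    by apply: cboundedM; apply: cboundedZ; exact: cbounded_mono.
  rewrite cexpectation_sum => [|u _]; last by apply: cbounded_sum.
  apply: eq_bigr => u _; rewrite cexpectation_sum // mulr_sumr; apply: eq_bigr => v _.
  under eq_cexpectation do rewrite mulrACA.
  rewrite cexpectationZ ?mulrA //.
  by apply: cboundedM; exact: cbounded_mono.
have -> : a * b = bext (fun u v => mono_mean N u * mono_mean N v) x y.
  rewrite /a /b /bext /lext big_distrlr /=; apply: eq_bigr => u _.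
  by rewrite mulr_sumr; apply: eq_bigr => v _; rewrite mulrACA -mulrA.
rewrite /bext /lext -sumrB; apply: eq_bigr => u _; rewrite -mulrBr -sumrB.
by congr (_ * _); apply: eq_bigr => v _; rewrite mulrBr.
Qed.

Lemma fact_neq0 N : N`!%:R != 0 :> R[i].
Proof. by rewrite pnatr_eq0 -lt0n fact_gt0. Qed.

(** Only points on short cycles contribute to the mean of a nontrivial
    monomial. *)
Lemma mono_mean_bound u : u != 1%g -> exists C N0 : nat,
  forall N, (N0 <= N)%N -> `|mono_mean N u| <= C%:R.
Proof.
case: u => f g u1; pose K := (2 * Defs.diam f + `|g|)%N.
exists (2 * K)%N, (2 * K).+1 => N hN.
rewrite /mono_mean /mono_trace (mean_tr_monomial hq) /= -[X in `|X|]subr0.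
apply: (@ratio_close _ _ 0); rewrite ?fact_gt0 //.
have fg : (f != 0) || (g != 0).
  by rewrite -negb_and; apply: contra u1 => /andP[/eqP -> /eqP ->].
apply: (@leq_trans (\sum_(s : 'S_N) #|short K s|)).
  apply: leq_sum => s _; apply: subset_leq_card.
  exact: fixed_set_short fg (@supp_within_diam f) (leqnn _).
by have := @sum_short 'I_N K; rewrite card_ord; apply; lia.
Qed.

Lemma cvg_mono_mean u : (fun N => N%:R^-1 * mono_mean N u : R[i]^o) @ \oo -->
  ((u == 1%g)%:R : R[i]^o).
Proof.
case: (eqVneq u 1%g) => [->|u1].
  apply: (@cvg_rate _ _ _ 0 1) => N N0.
  rewrite /mono_mean /mono_trace (mean_tr_monomial hq) /=.
  under eq_bigr do rewrite fixed_set_one card_ord.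
  rewrite sum_nat_const card_Sn natrM.
  have NR : N%:R != 0 :> R[i] by rewrite pnatr_eq0 -lt0n.
  by rewrite mulrAC mulfV ?fact_neq0 // mul1r mulVf // subrr normr0 mul0r.
have [C [N0 H]] := mono_mean_bound u1.
apply: (@cvg_rate _ _ _ C N0) => N hN.
by rewrite sub0r normrN normrM normfV normr_nat mulrC ler_wpM2r ?invr_ge0 ?ler0n ?H.
Qed.

(** Bounded means vanish after division by [N]; only the identity remains. *)
Lemma Phi1E x : Phi1 M x = mcoeff 1%g x.
Proof.
rewrite -lext_delta /Phi1; apply: (@cvg_lim R[i]^o); first exact: norm_hausdorff.
have -> : (fun N => N%:R^-1 * mean_trace M N x : R[i]^o) =
    (fun N => lext (fun u => N%:R^-1 * mono_mean N u) x : R[i]^o).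
  apply/funext => N; rewrite mean_traceE /lext mulr_sumr.
  by apply: eq_bigr => u _; rewrite mulrCA.
by apply: cvg_lext => u _; exact: cvg_mono_mean.
Qed.

Definition matched u v : bool :=
  [&& u.2 == 0, v.2 == 0 & `[< exists b, u.1 + translate b v.1 = 0 >]].

(** Off the short cycles, each point has exactly one partner if the configurations
    match and none otherwise; pairs on short cycles are controlled by the second
    moment. *)
Lemma mono_mean2_bound u v : u.1 != 0 -> v.1 != 0 -> exists C N0 : nat,
  forall N, (N0 <= N)%N -> `|mono_mean2 N u v - ((matched u v : nat) * N)%:R| <= C%:R.
Proof.
case: u v => f g [h g'] /= f0 h0.
pose K := (4 * (Defs.diam f + Defs.diam h) + `|g| + `|g'|)%N.
exists (6 * K ^ 2)%N, (4 * K).+1 => N hN.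
have N0 : (0 < #|'I_N|)%N by rewrite card_ord; lia.
have S2 := @sum_short_sqr 'I_N K N0; rewrite card_ord in S2.
have {}S2 := S2 (ltnW hN).
rewrite /mono_mean2 /mono_trace (mean_tr_monomial2 hq) /=.
set c : nat := matched (f, g) (h, g').
have near (s : 'S_N) : (#|matched_pairs s f g h g'| <= c * N + #|short K s| ^ 2)%N /\
    (c * N <= #|matched_pairs s f g h g'| + #|short K s| ^ 2)%N.
  rewrite /c; case: (boolP (matched (f, g) (h, g'))) => [|no].
    move=> /and3P[/= /eqP g0 /eqP g'0 /asboolP[b e]].
    have := card_matched_pairs_hit f0 h0 (@supp_within_diam f) (@supp_within_diam h)
      (leqnn K) s g0 g'0 e.
    have : (#|short K s| <= #|short K s| ^ 2)%N.
      by rewrite expnS expn1; case: #|short K s| => // a; exact: leq_pmull.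
    rewrite card_ord mul1n; move: (#|short K s| ^ 2)%N => a ha [lo up]; split=> //.
    by apply: leq_trans lo _; rewrite leq_add2l.
  rewrite mul0n add0n; split=> //.
  apply: card_matched_pairs_miss f0 h0 (@supp_within_diam f) (@supp_within_diam h)
    (leqnn K) s _.
  move=> [g0 g'0 ex]; case/negP: no; rewrite /matched /= g0 g'0 !eqxx /=.
  exact/asboolP.
have cN : (c * N * N`! = \sum_(s : 'S_N) c * N)%N.
  by rewrite sum_nat_const card_Sn mulnC.
apply: ratio_close; rewrite ?fact_gt0 // cN; apply: leq_trans (leq_add (leqnn _) S2);
  by rewrite -big_split /=; apply: leq_sum => s _; have [] := near s.
Qed.

(** The product of the means is bounded, so that subtracting it does not change
    the limit. *)
Lemma cvg_covariance u v : u.1 != 0 -> v.1 != 0 ->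
  (fun N => N%:R^-1 * (mono_mean2 N u v - mono_mean N u * mono_mean N v) : R[i]^o) @ \oo -->
  ((matched u v)%:R : R[i]^o).
Proof.
move=> u0 v0; have [C [N0 H]] := mono_mean2_bound u0 v0.
have ne1 (w : G) : w.1 != 0 -> w != 1%g by apply: contraNneq => ->.
have [Cu [Nu Hu]] := mono_mean_bound (ne1 _ u0).
have [Cv [Nv Hv]] := mono_mean_bound (ne1 _ v0).
apply: (@cvg_rate _ _ _ (C + Cu * Cv) (maxn N0 (maxn Nu (maxn Nv 1)))) => N.
rewrite !geq_max => /and4P[hN hu hv N1].
have NR : N%:R != 0 :> R[i] by rewrite pnatr_eq0 -lt0n.
have -> : (matched u v)%:R - N%:R^-1 * (mono_mean2 N u v - mono_mean N u * mono_mean N v) =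
    N%:R^-1 * (mono_mean N u * mono_mean N v - (mono_mean2 N u v - ((matched u v : nat) * N)%:R)).
  by rewrite natrM; field.
rewrite normrM normfV normr_nat mulrC ler_wpM2r ?invr_ge0 ?ler0n //.
apply: le_trans (ler_normB _ _) _; rewrite [leLHS]addrC natrD (natrM _ Cu Cv).
by apply: lerD; [exact: H | rewrite normrM; apply: ler_pM => //; [exact: Hu | exact: Hv]].
Qed.

Lemma Phi2E x y : {in msupp x, forall u, u.1 != 0} -> {in msupp y, forall v, v.1 != 0} ->
  Phi2 M x y = bext (fun u v => (matched u v)%:R) x y.
Proof.
move=> x0 y0; rewrite /Phi2; apply: (@cvg_lim R[i]^o); first exact: norm_hausdorff.
rewrite (_ : (fun N => _) = (fun N => bext (fun u v =>
    N%:R^-1 * (mono_mean2 N u v - mono_mean N u * mono_mean N v)) x y : R[i]^o)).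
  apply: cvg_lext => u ux; apply: cvg_lext => v vy.
  by apply: cvg_covariance; [exact: x0 | exact: y0].
apply/funext => N; rewrite covarianceE /bext /lext mulr_sumr; apply: eq_bigr => u _.
rewrite mulrCA; congr (_ * _); rewrite mulr_sumr; apply: eq_bigr => v _.
by rewrite mulrCA.
Qed.

End Kernels.

(** * Sums of translates *)
Section Shifts.
Variables (R : realType) (m0 r2 t : nat) (q : 'I_t -> nat).
Local Notation Lambda := (Lam m0 r2 q).
Local Notation G := (lamp m0 r2 q).
Implicit Types (f h : malg int Lambda) (g k b : int) (u v : G) (x y : galg R G).

Lemma translate0 g : translate g 0 = 0 :> malg int Lambda.
Proof. by apply/malgP => k; rewrite translateE !mcoeff0. Qed.

Lemma mul_shift u k : (u * ((0, k) : G))%g = (u.1, u.2 + k).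
Proof. by rewrite /mulg /= /wr_mul /= translate0 addr0. Qed.

Lemma mul_shift_eq1 u k : ((u * ((0, - k) : G))%g == 1%g) = (u == ((0, k) : G)).
Proof.
rewrite mul_shift; case: u => f g /=; apply/eqP/eqP => [[-> /eqP]|[-> ->]].
  by rewrite subr_eq0 => /eqP ->.
by rewrite subrr.
Qed.

Lemma lamp_mul_eq1 f h g g' : ((((f, g) : G) * ((h, g') : G))%g == 1%g) =
  (f + translate g h == 0) && (g + g' == 0).
Proof. by []. Qed.

Lemma filt_supp p x u : filt p x -> u \in msupp x ->
  (Defs.diam u.1 <= p)%N /\ (`|u.2| <= p)%N.
Proof.
move=> [n [a [z [zS ->]]]]; rewrite -mcoeff_neq0 raddf_sum /= => nz.
have [i /= ui] : exists i, mcoeff u (z i) != 0.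
  apply: contrapT => no; case/negP: nz; apply/eqP; apply: big1 => i _.
  rewrite mcoeffZ; case: (eqVneq (mcoeff u (z i)) 0) => [->|ui]; first by rewrite mulr0.
  by case: no; exists i.
have [f [g [fp gp zE]]] := zS i.
move: ui; rewrite zE mcoeffU; case: (eqVneq ((f, g) : G) u) => [<- //|_].
by rewrite mulr0n eqxx.
Qed.

Lemma lext_shift_sum (H : G -> R[i]) x (r : nat) : lext H (shift_sum x r) =
  lext (fun u => \sum_(p < (2 * r).+1) H (u.1, u.2 + (r%:Z - p%:Z))) x.
Proof.
rewrite /shift_sum lext_sum.
under eq_bigr do rewrite /galg_shift galg_mulU lext_sum.
rewrite exchange_big; apply: eq_bigr => u _; rewrite mulr_sumr; apply: eq_bigr => p _.
by rewrite lextZ lextU mul_shift opprB.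
Qed.

Lemma mcoeff_shift_sum x (r : nat) g : (forall k, mcoeff ((0, k) : G) x = 0) ->
  mcoeff ((0, g) : G) (shift_sum x r) = 0.
Proof.
move=> x0; rewrite -lext_delta lext_shift_sum /lext big_seq big1 // => -[f k] fx.
rewrite big1 ?mulr0 // => p _; case: eqP => // -[f0 _].
by rewrite f0 -mcoeff_neq0 x0 eqxx in fx.
Qed.

Lemma bext_shift_sum (K : G -> G -> R[i]) x y (r s : nat) :
  bext K (shift_sum x r) (shift_sum y s) =
  bext (fun u v => \sum_(p < (2 * r).+1) \sum_(p' < (2 * s).+1)
    K (u.1, u.2 + (r%:Z - p%:Z)) (v.1, v.2 + (s%:Z - p'%:Z))) x y.
Proof.
rewrite /bext lext_shift_sum; apply: eq_lext => u _.
under eq_bigr do rewrite lext_shift_sum.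
rewrite /lext exchange_big; apply: eq_bigr => v _; rewrite mulr_sumr.
by apply: eq_bigr.
Qed.

Lemma sum_pair_one (P Q : nat) (e : 'I_P -> 'I_Q -> bool) p0 p1 :
  (forall p p', e p p' = (p == p0) && (p' == p1)) ->
  \sum_(p < P) \sum_(p' < Q) (e p p')%:R = 1 :> R[i].
Proof.
move=> eE; rewrite (bigD1 p0) //= [X in _ + X]big1 => [|p np]; last first.
  by rewrite big1 // => p' _; rewrite eE (negbTE np).
rewrite (bigD1 p1) //= big1 => [|p' np]; first by rewrite eE !eqxx !addr0.
by rewrite eE (negbTE np) andbF.
Qed.

Lemma match_small f h b (n m : nat) : f != 0 -> supp_within n f -> supp_within m h ->
  f + translate b h = 0 -> (`|b| <= n + m)%N.
Proof.
move=> /malg_neq0P[k kf] fn hm /malgP/(_ k).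
rewrite mcoeffD translateE mcoeff0 => /eqP; rewrite addr_eq0 => /eqP fk.
have : k - b \in msupp h by rewrite -mcoeff_neq0 -oppr_eq0 -fk mcoeff_neq0.
by move/hm; have := fn k kf; lia.
Qed.

(** If [f] and the translate of [h] by [b] cancel, each side has exactly one
    nonzero term: [(g, g')] on the left, [(g - b, g' + b)] on the right. *)
Lemma matched_sum (f h : malg int Lambda) (g g' : int) (n m r s : nat) :
  f != 0 -> h != 0 -> supp_within n f -> supp_within m h ->
  (`|g| <= n)%N -> (`|g'| <= m)%N -> (2 * n + m <= r)%N -> (n + 2 * m <= s)%N ->
  \sum_(p < (2 * r).+1) \sum_(p' < (2 * s).+1)
    (matched ((f, g + (r%:Z - p%:Z)) : G) ((h, g' + (s%:Z - p'%:Z)) : G))%:R =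
  \sum_(p < (2 * r).+1) \sum_(p' < (2 * s).+1)
    (((((f, g + (r%:Z - p%:Z)) : G) * ((h, g' + (s%:Z - p'%:Z)) : G))%g == 1%g))%:R :> R[i].
Proof.
move=> f0 h0 fn hm gn gm nr ms.
have [[b e]|no] := pselect (exists b, f + translate b h = 0); last first.
  rewrite !big1 // => p _; rewrite big1 // => p' _.
    rewrite lamp_mul_eq1; case: eqP => // e; by case: no; exists (g + (r%:Z - p%:Z)).
  by rewrite /matched asboolF // !andbF.
have bnm := match_small f0 fn hm e.
have bE k : (f + translate k h == 0) = (k == b).
  by apply/eqP/eqP => [ek|->] //; exact: (translate_unique h0 hm ek e).
rewrite (@sum_pair_one _ _ _ (inord `|g + r%:Z|) (inord `|g' + s%:Z|)); last first.
  move=> p p'; rewrite /matched /= (asboolT (ex_intro _ b e)) andbT.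
  rewrite -!val_eqE /= !inordK; [|by lia|by lia].
  by congr (_ && _); lia.
rewrite (@sum_pair_one _ _ _ (inord `|g - b + r%:Z|) (inord `|g' + b + s%:Z|)) //.
move=> p p'; rewrite lamp_mul_eq1 bE -!val_eqE /= !inordK; [|by lia|by lia].
by lia.
Qed.

End Shifts.

Theorem proposition6p4
    (R : realType) (m0 r2 t : nat) (q : 'I_t -> nat)
    (hq : forall j : 'I_t, (3 <= q j)%N)
    (M : forall N : nat, matrix_model R m0 r2 q N)
    (m n : nat) (x y : galg R (lamp m0 r2 q))
    (hx : filt n x) (hy : filt m y)
    (hx0 : forall k : int,
       Phi1 M (galg_mul x (U R ((0, k) : lamp m0 r2 q))) = 0)
    (hy0 : forall k : int,
       Phi1 M (galg_mul y (U R ((0, k) : lamp m0 r2 q))) = 0)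
    (r s : nat) (hr : (2 * n + m <= r)%N) (hs : (n + 2 * m <= s)%N) :
  Phi2 M (shift_sum x r) (shift_sum y s) =
  Phi1 M (galg_mul (shift_sum x r) (shift_sum y s)).
Proof.
pose G := lamp m0 r2 q.
have pure (z : galg R G) : (forall k, Phi1 M (galg_mul z (U R ((0, k) : G))) = 0) ->
    forall k, mcoeff ((0, k) : G) z = 0.
  move=> z0 k; rewrite -lext_delta -[RHS](z0 (- k)) (Phi1E hq) mcoeff1_galg_mul.
  apply: eq_lext => u _; rewrite lextU; congr (nat_of_bool _)%:R.
  by rewrite mul_shift_eq1.
have lamps (z : galg R G) : (forall k, mcoeff ((0, k) : G) z = 0) ->
    {in msupp z, forall u : G, u.1 != 0}.
  move=> z0 [f g]; rewrite -mcoeff_neq0 /=; apply: contraNneq => ->.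
  by rewrite z0.
have x0 := pure x hx0; have y0 := pure y hy0.
(* Shifts keep the lamp configurations, so those of both sums are nonzero. *)
rewrite (Phi2E hq); [|by apply: lamps => k; exact: mcoeff_shift_sum..].
rewrite (Phi1E hq) mcoeff1_galg_mul !bext_shift_sum.
apply: eq_lext => u ux; apply: eq_lext => v vy.
have [du gu] := filt_supp hx ux; have [dv gv] := filt_supp hy vy.
apply: matched_sum gu gv hr hs; try exact: lamps ux; try exact: lamps vy.
  exact: supp_withinW du (@supp_within_diam _ _ _ _ u.1).
exact: supp_withinW dv (@supp_within_diam _ _ _ _ v.1).
Qed.
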